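(* Let $n\geq 19$ with $n\equiv 3\pmod 4$ and $r=(n-3)/2$. Let $V$ consist of the $n$ distinct vertices $p_1,p_2,p_3,p_4,y_2,\dots,y_{r+1},z_3,\dots,z_{r+1}$. Consider the labelled graph on $V$ with edges: $\{p_1,p_2\}$ with label $0$; $\{p_2,p_3\}$ with label $1$; $\{p_3,p_4\}$ with the two labels $0$ and $2$; $\{p_4,y_2\}$ with label $1$; $\{y_k,y_{k+1}\}$ with label $k$ for $2\leq k\leq r-1$; $\{y_r,y_{r+1}\}$ with label $r-2$; $\{z_k,z_{k+1}\}$ with label $k$ for $3\leq k\leq r-1$; $\{z_r,z_{r+1}\}$ with label $r-2$; and $\{y_j,z_j\}$ with label $r-4$ for $j\in\{r-2,r-1,r,r+1\}$. Then $G\cong A_n$ and $(G,(\rho_0,\dots,\rho_{r-1}))$ is a string C-group of rank $r$ with Schläfli type $\{5,5,6,3^{r-8},6,6,6,4\}$.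
   Context: A string group generated by involutions (sggi) of rank $r$ is a pair $(G,(\rho_0,\dots,\rho_{r-1}))$ where $\rho_0,\dots,\rho_{r-1}$ are involutions generating the group $G$ such that $(\rho_i\rho_j)^2=1$ whenever $|i-j|\geq 2$. It is a string C-group if in addition it satisfies the intersection property: for all $J,K\subseteq\{0,\dots,r-1\}$, $\langle \rho_j : j\in J\rangle\cap\langle\rho_k : k\in K\rangle=\langle \rho_j : j\in J\cap K\rangle$. The Schläfli type is $\{p_1,\dots,p_{r-1}\}$ where $p_i$ is the order of $\rho_{i-1}\rho_i$; $3^k$ denotes $k$ consecutive entries equal to $3$ (omitted if $k=0$). Labelled-graph convention: the vertex set $V$ is finite, and each edge $\{a,b\}$ ($a\neq b$) carries one or more labels from $\{0,\dots,r-1\}$, the edges carrying any given label being pairwise disjoint; $\rho_k$ denotes the permutation of $V$ equal to the product of the transpositions $(a\,b)$ over all edges $\{a,b\}$ carrying label $k$, and $G=\langle\rho_0,\dots,\rho_{r-1}\rangle\leq \mathrm{Sym}(V)$. *)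

(* Defs.v *)
From mathcomp Require Import all_boot all_fingroup all_solvable.
Set Implicit Arguments. Unset Strict Implicit. Unset Printing Implicit Defensive.
Local Open Scope group_scope.

Definition gen_by (gT : finGroupType) (r : nat) (rho : nat -> gT)
  (J : {set 'I_r}) : {set gT} := <<[set rho (val j) | j in J]>>.

Definition sggi (gT : finGroupType) (G : {set gT}) (r : nat) (rho : nat -> gT)
  : Prop :=
  [/\ forall i, i < r -> #[rho i] = 2,
      gen_by rho [set: 'I_r] = G &
      forall i j, i < r -> j < r -> (i.+1 < j) || (j.+1 < i) ->
        (rho i * rho j) ^+ 2 = 1].

Definition intersection_property (gT : finGroupType) (r : nat)
  (rho : nat -> gT) : Prop :=
  forall J K : {set 'I_r},
    gen_by rho J :&: gen_by rho K = gen_by rho (J :&: K).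

Definition string_C_group (gT : finGroupType) (G : {set gT}) (r : nat)
  (rho : nat -> gT) : Prop :=
  sggi G r rho /\ intersection_property r rho.

Definition schlafli (gT : finGroupType) (r : nat) (rho : nat -> gT) : seq nat :=
  [seq #[rho i.-1 * rho i] | i <- iota 1 r.-1].

(* Vertex set V = 'I_n, with the encoding
   p1,p2,p3,p4 = 0,1,2,3 ;  y_k = k+2 (2 <= k <= r+1) ;
   z_k = r+k+1 (3 <= k <= r+1).  These are the n = 2r+3 distinct vertices. *)
Definition rk (n : nat) : nat := (n - 3) %/ 2.
Definition vp1 : nat := 0.
Definition vp2 : nat := 1.
Definition vp3 : nat := 2.
Definition vp4 : nat := 3.
Definition vy (k : nat) : nat := k + 2.
Definition vz (r k : nat) : nat := r + k + 1.

(* Labelled edges, as (label, (a, b)); an edge with two labels appears twice. *)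
Definition lab_edges (n : nat) : seq (nat * (nat * nat)) :=
  let r := rk n in
  ([:: (0, (vp1, vp2)); (1, (vp2, vp3)); (0, (vp3, vp4)); (2, (vp3, vp4));
      (1, (vp4, vy 2))]
  ++ [seq (k, (vy k, vy k.+1)) | k <- iota 2 (r - 2)]
  ++ [:: (r - 2, (vy r, vy r.+1))]
  ++ [seq (k, (vz r k, vz r k.+1)) | k <- iota 3 (r - 3)]
  ++ [:: (r - 2, (vz r r, vz r r.+1))]
  ++ [seq (r - 4, (vy j, vz r j)) | j <- [:: r - 2; r - 1; r; r + 1]])%N.

Definition tp (n a b : nat) : {perm 'I_n} :=
  match @insub _ (fun x => x < n) 'I_n a, @insub _ (fun x => x < n) 'I_n b with
  | Some x, Some y => tperm x y
  | _, _ => 1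
  end.

Definition rho (n k : nat) : {perm 'I_n} :=
  \prod_(e <- lab_edges n | e.1 == k) tp n e.2.1 e.2.2.

Definition Ggrp (n : nat) : {set {perm 'I_n}} :=
  gen_by (rho n) [set: 'I_(rk n)].

(* Main.v *)
Require Import Defs.
From mathcomp Require Import all_boot all_fingroup all_solvable.
From mathcomp Require Import zify.
Set Implicit Arguments. Unset Strict Implicit. Unset Printing Implicit Defensive.
Local Open Scope group_scope.

(** The intersection property reduces to the inclusion of
    $\langle\rho_0,\dots,\rho_m\rangle\cap\langle\rho_k,\dots,\rho_{r-1}\rangle$ in
    $\langle\rho_k,\dots,\rho_m\rangle$. Elements of the first group move the last
    blocks $\{y_j,z_j\}$, $j>m+1$, only through a group of order 1, 2 or 4, and for
    $m\le r-4$ do not mix the $y$'s with the $z$'s; for $k\ge 3$ elements of the second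
    group fix everything before $y_k, z_k$ and permute the blocks. For $k\ge 3$, an even
    permutation satisfying both constraints is reduced to the identity by multiplying it
    with elements of $\langle\rho_k,\dots,\rho_m\rangle$ that fix one base point after
    another; beyond $k=r-5$ only 14 points are left, and the walks through the orbits
    are checked by computation. For $k\le 2<m$ the group
    $\langle\rho_k,\dots,\rho_m\rangle$ contains the 3-cycle $(\rho_2\rho_3)^2$, and
    conjugating it along the edges gives all even permutations of the $y$'s, and of the
    $z$'s too if $m\ge r-3$; with $k=0$, $m=r-1$ this is $A_n$. For $m\le 2$ a coset
    enumeration suffices. *)

(** No group orders are available for general $r$, so membership in
    $\langle\rho_k,\dots,\rho_m\rangle$ is proved by sifting. The invariants are mere necessary
    conditions; they only have to be sharp enough that every image they allow is reached by a walk.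
    The 14 points are the blocks with indices $r-5,\dots,r+1$: on them $\rho_{r-5},\dots,\rho_{r-1}$
    act in a way independent of $r$, so one finite check serves all ranks. The constant $r-5$ comes
    from $(\rho_{r-5}\rho_{r-4})^3$, which exchanges $y_j$ and $z_j$ in the last four blocks and
    fixes everything else; conjugates of it treat $y$'s and $z$'s independently. Where the walks
    leave an ambiguity, it is a swap inside a single block, and parity excludes it. The split at
    $k=3$ comes from $y_2$, which has no partner: $\rho_2$ exchanges $y_2$ and $y_3$ and so destroys
    the blocks, while every later generator preserves them. Thus 3-cycles are at hand exactly where
    the block argument fails. *)

(** * Permutations as functions on natural numbers, extended by the identity *)

Definition ev n (s : {perm 'I_n}) (i : nat) : nat :=
  if @insub nat (fun x => x < n) 'I_n i is Some x then val (s x) else i.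

Lemma ev_val n (s : {perm 'I_n}) (x : 'I_n) : ev s x = s x.
Proof. by rewrite /ev valK. Qed.

Lemma ev_out n (s : {perm 'I_n}) i : n <= i -> ev s i = i.
Proof. by move=> ni; rewrite /ev insubN // -leqNgt. Qed.

Lemma ev_lt n (s : {perm 'I_n}) i : i < n -> ev s i < n.
Proof. by move=> lin; rewrite (ev_val s (Ordinal lin)). Qed.

Lemma ev1 n i : ev (1 : {perm 'I_n}) i = i.
Proof.
case: (ltnP i n) => [lin|/ev_out->//].
by rewrite (ev_val _ (Ordinal lin)) perm1.
Qed.

Lemma evM n (s t : {perm 'I_n}) i : ev (s * t) i = ev t (ev s i).
Proof.
case: (ltnP i n) => [lin|ni]; last by rewrite !ev_out.
by rewrite (ev_val s (Ordinal lin)) !ev_val (ev_val _ (Ordinal lin)) permM.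
Qed.

Lemma evK n (s : {perm 'I_n}) : cancel (ev s) (ev s^-1).
Proof. by move=> i; rewrite -evM mulgV ev1. Qed.

Lemma ev_inj n (s : {perm 'I_n}) : injective (ev s).
Proof. exact: can_inj (evK s). Qed.

Lemma eq_ev n (s t : {perm 'I_n}) :
  (forall i, i < n -> ev s i = ev t i) -> s = t.
Proof. by move=> e; apply/permP=> x; apply/val_inj; rewrite /= -!ev_val e. Qed.

Lemma ev_tp n a b i : a < n -> b < n ->
  ev (tp n a b) i = if i == a then b else if i == b then a else i.
Proof.
move=> an bn; rewrite /tp !insubT.
case: (ltnP i n) => [lin|ni]; last first.
  by rewrite ev_out //; case: eqP => [|_]; [lia | case: eqP => //; lia].
rewrite (ev_val _ (Ordinal lin)) permE /= -!val_eqE /=.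
by case: ifP => // _; case: ifP.
Qed.

Lemma odd_tp n a b : a < b < n -> odd_perm (tp n a b).
Proof.
case/andP=> ab bn; rewrite /tp !insubT ?(ltn_trans ab bn) // => an.
by rewrite odd_tperm -val_eqE /= ltn_eqF.
Qed.

(** * Explicit action of the generators *)

(** Adding $r-1$ carries $y_j$ to $z_j$, and [r.*2.+1], [r.*2.+2] are $z_r$, $z_{r+1}$. The branches
    for the labels 0, 1, 2 do not involve [r]. *)
Definition mv (r k i : nat) : nat := (
  if k == 0 then
    if i == 0 then 1 else if i == 1 then 0 else
    if i == 2 then 3 else if i == 3 then 2 else i
  else if k == 1 then
    if i == 1 then 2 else if i == 2 then 1 else
    if i == 3 then 4 else if i == 4 then 3 else i
  else if k == 2 then
    if i == 2 then 3 else if i == 3 then 2 else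
    if i == 4 then 5 else if i == 5 then 4 else i
  else
    if i == k + 2 then k + 3 else if i == k + 3 then k + 2 else
    if i == r + k + 1 then r + k + 2 else if i == r + k + 2 then r + k + 1 else
    if k + 2 == r then
      if i == r + 2 then r + 3 else if i == r + 3 then r + 2 else
      if i == r.*2.+1 then r.*2.+2 else if i == r.*2.+2 then r.*2.+1 else i
    else if k + 4 == r then
      if (r <= i) && (i <= r + 3) then i + (r - 1) else
      if (r.*2.-1 <= i) && (i <= r.*2.+2) then i - (r - 1) else i
    else i)%N.

Lemma filter_label a m k (f : nat -> nat * nat) :
  [seq x <- [seq (j, f j) | j <- iota a m] | x.1 == k] =
  if a <= k < a + m then [:: (k, f k)] else [::].
Proof.
rewrite filter_map (eq_filter (a2 := pred1 k)) //.
case: ifP => h.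
  by rewrite filter_pred1_uniq ?iota_uniq ?mem_iota.
apply/nilP; rewrite /nilp size_map size_filter.
by rewrite (count_uniq_mem _ (iota_uniq _ _)) mem_iota h.
Qed.

Definition lab_filter r k : seq (nat * (nat * nat)) := (
  if k == 0 then [:: (0, (0, 1)); (0, (2, 3))] else
  if k == 1 then [:: (1, (1, 2)); (1, (3, 4))] else
  if k == 2 then [:: (2, (2, 3)); (2, (4, 5))] else
  if r <= k then [::] else
  [:: (k, (k + 2, k + 3))] ++
  (if k + 2 == r then [:: (k, (r + 2, r + 3))] else [::]) ++
  [:: (k, (r + k + 1, r + k + 2))] ++
  (if k + 2 == r then [:: (k, (r.*2.+1, r.*2.+2))] else [::]) ++
  (if k + 4 == r then [:: (k, (r, r.*2.-1)); (k, (r + 1, r.*2));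
     (k, (r + 2, r.*2.+1)); (k, (r + 3, r.*2.+2))] else [::]))%N.


Lemma filter_label_cons l e (es : seq (nat * (nat * nat))) k :
  [seq x <- (l, e) :: es | x.1 == k] =
  (if l == k then [:: (l, e)] else [::]) ++ [seq x <- es | x.1 == k].
Proof. by rewrite /=; case: ifP. Qed.

(** Leaves at most six explicit transpositions in each generator; $r\ge 8$ keeps the labels $r-4$
    and $r-2$ of the extra edges away from 0, 1, 2. *)
Lemma lab_edges_filter n r k : 8 <= r -> n = r.*2.+3 ->
  [seq x <- lab_edges n | x.1 == k] = lab_filter r k.
Proof.
move=> r8 En; rewrite /lab_edges (_ : rk n = r); last by rewrite /rk; lia.
have E2 : (2 <= k < 2 + (r - 2)) = (2 <= k < r) by lia.
have E3 : (3 <= k < 3 + (r - 3)) = (3 <= k < r) by lia.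
have E4 : (r - 2 == k) = (k + 2 == r) by lia.
have E5 : (r - 4 == k) = (k + 4 == r) by lia.
rewrite !filter_cat !(filter_label _ _ _ (fun k => (_, _))) E2 E3 map_cons.
rewrite !filter_label_cons E4 E5 /lab_filter /vy /vz /vp1 /vp2 /vp3 /vp4.
clear E2 E3 E4 E5; 
case: (ltnP k 3) => k3.
  have -> : (k + 2 == r) = false by lia.
  have -> : (k + 4 == r) = false by lia.
  by case: k k3 => [|[|[|]]] //= _; rewrite ifT //; lia.
have -> : (0%N == k) = false by lia.
have -> : (1%N == k) = false by lia.
have -> : (2 == k) = false by lia.
have -> : (k == 0%N) = false by lia.
have -> : (k == 1%N) = false by lia.
have -> : (k == 2) = false by lia.
rewrite (ltnW k3) !andTb.
case: (ltnP k r) => kr; last first.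
  have -> : (k + 2 == r) = false by lia.
  by have -> : (k + 4 == r) = false by lia.
rewrite !cat0s /= (_ : k.+1 + 2 = k + 3) 1?(_ : r + k.+1 + 1 = r + k + 2); [|lia..].
case: eqP => [e2|_] /=.
  have -> : (k + 4 == r) = false by lia.
  by do !congr (_ :: _); congr (_, (_, _)); lia.
case: eqP => [e4|_] //=.
by do !congr (_ :: _); congr (_, (_, _)); lia.
Qed.

(** Splits on tests that contain no further conditional, so that [lia] only ever sees plain
    arithmetic; contradictory branches are discarded at once. *)
Ltac ifs := repeat
  match goal with |- context [if ?b then _ else _] =>
    match b with
    | context [if _ then _ else _] => fail 1
    | _ => let h := fresh in case h: b; move: h => ?; try (exfalso; lia)
    end
  end; lia.

Lemma ev_rho n r k i : 8 <= r -> n = r.*2.+3 -> k < r ->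
  ev (rho n k) i = mv r k i.
Proof.
move=> r8 En kr; rewrite /rho -big_filter (lab_edges_filter _ r8 En) /lab_filter /mv.
case: ifP => _; first by rewrite !big_cons big_nil mulg1 evM !ev_tp /=; [ifs|lia..].
case: ifP => _; first by rewrite !big_cons big_nil mulg1 evM !ev_tp /=; [ifs|lia..].
case: ifP => _; first by rewrite !big_cons big_nil mulg1 evM !ev_tp /=; [ifs|lia..].
rewrite leqNgt kr [X in if X then _ else _]/=.
case: ifP => [e2|_].
  rewrite ifN; last lia.
  by rewrite !big_cons big_nil mulg1 !evM !ev_tp /=; [ifs|lia..].
case: ifP => e4; last by rewrite !big_cons big_nil mulg1 !evM !ev_tp /=; [ifs|lia..].
by rewrite !big_cons big_nil mulg1 !evM !ev_tp /=; [ifs|lia..].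
Qed.

Lemma even_rho n r k : 8 <= r -> n = r.*2.+3 -> odd_perm (rho n k) = false.
Proof.
move=> r8 En; rewrite /rho -big_filter (lab_edges_filter _ r8 En) /lab_filter.
do 4 (case: ifP => ?; first by
  rewrite ?big_cons big_nil ?mulg1 ?odd_permM ?odd_tp ?odd_perm1 //=; lia).
by case: ifP => e2; case: ifP => e4;
  rewrite !big_cons big_nil mulg1 !odd_permM !odd_tp //=; lia.
Qed.

(* The point [pt r q] is $y_{r-5+q}$ for [q < 7] and $z_{r-12+q}$ for [7 <= q < 14]. *)
Definition pt (r q : nat) : nat :=
  (if q < 7 then r - 3 + q else r.*2 - 4 + (q - 7))%N.

Definition involution_of (s : seq (nat * nat)) (q : nat) : nat :=
  foldr (fun p x => if q == p.1 then p.2 else if q == p.2 then p.1 else x) q s.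

(* [top_mv j] is the action of $\rho_{r-j}$ on the indices of the points [pt r q]. *)
Definition top_mv (j : nat) : nat -> nat :=
  involution_of (nth [::] [:: [::];
    [:: (4, 5); (11, 12)];
    [:: (3, 4); (5, 6); (10, 11); (12, 13)];
    [:: (2, 3); (9, 10)];
    [:: (1, 2); (8, 9); (3, 10); (4, 11); (5, 12); (6, 13)];
    [:: (0, 1); (7, 8)]] j)%N.

Lemma mv_pt r j q : 8 <= r -> 0 < j <= 5 -> q < 14 ->
  mv r (r - j) (pt r q) = pt r (top_mv j q).
Proof.
move=> r8 hj hq; have {hj} : j \in iota 1 5 by rewrite mem_iota; lia.
rewrite !inE => hj; rewrite /pt /mv.
do 3 (rewrite ifN; [|lia]).
by case/or4P: hj => [/eqP->|/eqP->|/eqP->|/orP[]/eqP->]; rewrite /top_mv /=; ifs.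
Qed.

Lemma mv_not_pt r j i : 8 <= r -> 0 < j <= 5 -> (forall q, q < 14 -> i != pt r q) ->
  mv r (r - j) i = i.
Proof.
move=> r8 hj hi.
have [h1 h2] : (i < r - 3 \/ r + 3 < i) /\ (i < r.*2 - 4 \/ r.*2 + 2 < i).
  split; apply/orP/negPn; apply/negP => h.
  - by have := hi (i - (r - 3)); rewrite /pt; ifs.
  - by have := hi (i - (r.*2 - 4) + 7); rewrite /pt; ifs.
by rewrite /mv; ifs.
Qed.

(** * Reduction of the intersection property to intervals of labels *)

Definition itv r i j : {set 'I_r} := [set x : 'I_r | i <= x < j].

Section GeneratedSubgroups.
Variables (gT : finGroupType) (r : nat) (g : nat -> gT).
Implicit Types J K : {set 'I_r}.
Local Notation G := (gen_by (r := r) g).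

Canonical gen_by_group J := [group of G J].

Lemma gen_byS J K : J \subset K -> G J \subset G K.
Proof. by move=> sJK; rewrite genS // imsetS. Qed.

Lemma mem_gen_by J (k : 'I_r) : k \in J -> g k \in G J.
Proof. by move=> kJ; rewrite mem_gen // imset_f. Qed.

Lemma mem_gen_itv i j k : i <= k < j -> k < r -> g k \in G (itv r i j).
Proof. by move=> hk kr; apply: (@mem_gen_by _ (Ordinal kr)); rewrite inE. Qed.

(** In a finite group, products of generators suffice, so inverses never occur. The starting point
    [s] is arbitrary: an invariant of a permutation outside the subgroup can be carried through the
    multiplications of a sifting step. *)
Lemma gen_by_ind J (P : gT -> Prop) s h :
  (forall t (k : 'I_r), k \in J -> P t -> P (t * g k)) ->
  h \in G J -> P s -> P (s * h).
Proof.
move=> Pg /gen_prodgP[n [c cJ ->]] Ps.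
elim: n c cJ => [|n IHn] c cJ; first by rewrite big_ord0 mulg1.
rewrite big_ord_recr mulgA /=.
have /imsetP[k kJ ->] := cJ ord_max; apply: Pg => //.
by apply: IHn => i; apply: cJ.
Qed.

Lemma gen_byU J K : G (J :|: K) = G J <*> G K.
Proof. by rewrite /gen_by imsetU joing_idl joing_idr. Qed.

Hypothesis comm_g : forall i j, i < r -> j < r -> i.+1 < j -> commute (g i) (g j).

Lemma gen_byM J K :
  (forall j k : 'I_r, j \in J -> k \in K -> j.+1 < k) ->
  G (J :|: K) = G J * G K.
Proof.
move=> sep; rewrite gen_byU cent_joinEr // /gen_by cent_gen gen_subG.
apply/subsetP=> _ /imsetP[k kK ->]; apply/centP=> _ /imsetP[j jJ ->].
by apply/commute_sym/comm_g; rewrite ?ltn_ord ?sep.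
Qed.

Hypothesis itvI : forall m k, m <= r -> k < r ->
  G (itv r 0 m) :&: G (itv r k r) \subset G (itv r k m).

(** If $J$ has a gap, it splits into two commuting parts; the factor from the part without $a$
    avoids $a$ anyway, hence so does the other factor, and induction applies to it. If $J=[i,j]$,
    write $x=uv$ with $u$ from labels below $a$ and $v$ from labels above. Since $x$ and $v$ use
    only labels $\ge i$, so can $u$, and [itvI] confines $u$ to $[i,a)$; symmetrically for $v$. *)
Lemma gen_setD1 J a : G J :&: G [set~ a] \subset G (J :\ a).
Proof.
have [n] := ubnP #|J|; elim: n J => // n IHn J; rewrite ltnS => leJn.
case aJ: (a \in J); last first.
  by apply: subset_trans (subsetIl _ _) _; rewrite gen_byS // subsetD1 subxx aJ.
apply/subsetP=> x /setIP[xJ xa].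
case: (pickP [pred b | [&& b \notin J, [exists i in J, i < b] & [exists i in J, b < i]]]).
  move=> b /and3P[bJ /exists_inP[i iJ ib] /exists_inP[j jJ bj]].
  pose J1 := J :&: [set k : 'I_r | k < b]; pose J2 := J :&: [set k : 'I_r | b < k].
  have defJ : J = J1 :|: J2.
    apply/setP=> k; rewrite !inE; case kJ: (k \in J) => //=.
    by rewrite -neq_ltn; apply/esym; apply: contraNneq bJ => /val_inj <-.
  have sep (k l : 'I_r) : k \in J1 -> l \in J2 -> k.+1 < l.
    by rewrite !inE => /andP[_ kb] /andP[_]; apply: leq_ltn_trans.
  have ltJ1 : #|J1| < n.
    apply: leq_trans leJn; apply: proper_card; rewrite properE subsetIl /=.
    by apply/subsetPn; exists j => //; rewrite !inE jJ /= -leqNgt ltnW.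
  have ltJ2 : #|J2| < n.
    apply: leq_trans leJn; apply: proper_card; rewrite properE subsetIl /=.
    by apply/subsetPn; exists i => //; rewrite !inE iJ /= -leqNgt ltnW.
  have sC (L : {set 'I_r}) : a \notin L -> G L \subset G [set~ a].
    by move=> aL; rewrite gen_byS // subsetC sub1set inE.
  move: xJ; rewrite {1}defJ gen_byM // => /mulsgP[x1 x2 x1J x2J def_x].
  have [ab|ba] := ltnP a b.
    have aJ2 : a \notin J2 by rewrite !inE aJ /= -leqNgt ltnW.
    have x2a := subsetP (sC _ aJ2) _ x2J.
    have x1a : x1 \in G [set~ a] by rewrite -(groupMr _ x2a) -def_x.
    rewrite def_x groupM //.
      have := subsetP (IHn _ ltJ1) x1; rewrite inE x1J x1a => /(_ isT).
      by apply/subsetP; rewrite gen_byS // setSD // subsetIl.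
    move: x2J; apply/subsetP; rewrite gen_byS // subsetD1 aJ2 andbT; exact: subsetIl.
  have aJ1 : a \notin J1 by rewrite !inE aJ /= -leqNgt.
  have x1a := subsetP (sC _ aJ1) _ x1J.
  have x2a : x2 \in G [set~ a] by rewrite -(groupMl _ x1a) -def_x.
  rewrite def_x groupM //.
    move: x1J; apply/subsetP; rewrite gen_byS // subsetD1 aJ1 andbT; exact: subsetIl.
  have := subsetP (IHn _ ltJ2) x2; rewrite inE x2J x2a => /(_ isT).
  by apply/subsetP; rewrite gen_byS // setSD // subsetIl.
move=> nogap.
(* Without a gap, [J] is the interval from its least to its greatest element. *)
pose i := [arg min_(i < a in J) val i]; pose j := [arg max_(i > a in J) val i].
have [iJ minJ] : i \in J /\ forall k, k \in J -> i <= k by rewrite /i; case: arg_minnP.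
have [jJ maxJ] : j \in J /\ forall k, k \in J -> k <= j by rewrite /j; case: arg_maxnP.
have defJ : J = itv r i j.+1.
  apply/setP=> k; rewrite inE ltnS; apply/idP/andP=> [kJ|[]]; first by rewrite minJ ?maxJ.
  rewrite leq_eqVlt => /predU1P[/val_inj <- //|ik].
  rewrite leq_eqVlt => /predU1P[/val_inj -> //|kj].
  apply/negPn; have /= := nogap k; apply: contraFN => kJ; rewrite kJ /=.
  by apply/andP; split; apply/exists_inP; [exists i | exists j].
have ia := minJ _ aJ; have aj := maxJ _ aJ; have ar := ltn_ord a.
have sI i1 j1 i2 j2 : i2 <= i1 -> j1 <= j2 -> G (itv r i1 j1) \subset G (itv r i2 j2).
  by move=> *; apply/gen_byS/subsetP=> k; rewrite !inE; lia.
have defa : [set~ a] = itv r 0 a :|: itv r a.+1 r.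
  by apply/setP=> k; rewrite !inE -val_eqE /= ltn_ord andbT neq_ltn.
move: xa xJ; rewrite {1}defa {1}defJ gen_byM; last first.
  by move=> k l; rewrite !inE; lia.
case/mulsgP=> u v uA vA def_x xJ.
have xr : x \in G (itv r i r) by apply: subsetP xJ; rewrite sI //; exact: ltn_ord.
have x0 : x \in G (itv r 0 j.+1) by apply: subsetP xJ; rewrite sI.
have vr : v \in G (itv r i r) by apply: subsetP vA; rewrite sI //; lia.
have u0 : u \in G (itv r 0 j.+1) by apply: subsetP uA; rewrite sI // leqW.
have ui : u \in G (itv r i a).
  apply: (subsetP (itvI _ _)); rewrite ?inE ?uA ?ltn_ord ?(ltnW ar) //=.
  by rewrite -(groupMr _ vr) -def_x.
have vj : v \in G (itv r a.+1 j.+1).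
  case: (ltnP a.+1 r) => a1r.
    apply: (subsetP (itvI _ _)); rewrite ?inE ?vA ?ltn_ord ?andbT //=.
    by rewrite -(groupMl _ u0) -def_x.
  suff e : itv r a.+1 j.+1 = itv r a.+1 r by rewrite e.
  by apply/setP => k; rewrite !inE; have := ltn_ord k; clear -a1r aj; lia.
rewrite def_x groupM // ?(subsetP (gen_byS _) _ ui) ?(subsetP (gen_byS _) _ vj) //.
  by apply/subsetP=> k; rewrite defJ !inE -val_eqE /=; clear -ia aj; lia.
by apply/subsetP=> k; rewrite defJ !inE -val_eqE /=; clear -ia aj; lia.
Qed.

(** The labels of [J] outside [K] are deleted one at a time by [gen_setD1]: [K] lies in the
    complement of each of them. *)
Lemma intersection_of_itv : intersection_property r g.
Proof.
move=> J K; apply/eqP; rewrite eqEsubset; apply/andP; split; last first.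
  by rewrite subsetI !gen_byS ?subsetIl ?subsetIr.
have [n] := ubnP #|J :\: K|; elim: n J => // n IHn J; rewrite ltnS => leJn.
have [sJK|/subsetPn[a aJ aK]] := boolP (J \subset K).
  by rewrite (setIidPl sJK) subsetIl.
have aJK : a \in J :\: K by rewrite inE aK.
have := IHn (J :\ a); rewrite setDDl setUC -setDDl => IH.
have sIK : G J :&: G K \subset G (J :\ a) :&: G K.
  rewrite subsetI subsetIr andbT; apply: subset_trans (gen_setD1 J a).
  by rewrite setIS // gen_byS // subsetC sub1set inE.
have {}IH : G (J :\ a) :&: G K \subset G ((J :\ a) :&: K).
  by apply: IH; apply: leq_trans leJn; rewrite [X in _ < X](cardsD1 a) aJK.
apply: subset_trans sIK (subset_trans IH _).
by rewrite gen_byS // setSI // subsetDl.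
Qed.

End GeneratedSubgroups.

(** * Finite tables and checks on the last seven blocks *)

(** The cube of $\rho_{r-5}\rho_{r-4}$: the 3-cycles on the indices 0, 1, 2 and 7, 8, 9 disappear,
    and only the four exchanges $y_j\leftrightarrow z_j$ of $\rho_{r-4}$ remain. *)
Definition flip4 : seq nat := flatten (nseq 3 [:: 5; 4]).

Definition word_mv (w : seq nat) (q : nat) : nat := foldl (fun x j => top_mv j x) q w.

(* Indices [q] whose block $\{y_k,z_k\}$ has $k > m + 1$, for [m = r - j]
   ([j = 6] stands for all smaller [m]); the words in [top_words j] describe the
   permutations that $\langle\rho_0,\dots,\rho_m\rangle$ induces on these points. *)
Definition in_top (j q : nat) : bool := (1 < j) && (6 - j < q %% 7).
Definition top_words (j : nat) : seq (seq nat) :=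
  nth [::] [:: [::]; [:: [::]]; [:: [::]; [:: 2]; [:: 4]; [:: 2; 4]];
               [:: [::]; [:: 4]]; [:: [::]; flip4]; [:: [::]]; [:: [::]]] j.

(* [fixed_by i], [bottom_ok i] and [bottom_rel i] describe
   $\langle\rho_{r-i},\dots,\rho_{r-1}\rangle$: which points are fixed, where a point
   may go, and which relations between pairs of points are preserved. For [i = 4] the
   extra invariant is the partition of the moved points by [side]; for [i = 2] it is
   the pairing of the blocks $r-2,r+1$ and $r-1,r$. *)
Definition fixed_by (i q : nat) : bool :=
  nth false [:: false; q %% 7 \notin [:: 4; 5]; q %% 7 < 3; q %% 7 < 2; q %% 7 < 1] i.
Definition bottom_ok (i q w : nat) : bool :=
  if fixed_by i q then w == q
  else ~~ fixed_by i w && ((3 < i) || ((q < 7) == (w < 7))).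
(** The halves $y$ and $z$ with block $r-4$ crossed over: with this twist $\rho_{r-4}$ interchanges
    the two sides as a whole, while $\rho_{r-3},\rho_{r-2},\rho_{r-1}$ preserve each of them. *)
Definition side (q : nat) : bool := (q < 7) (+) (q %% 7 == 1%N).
Definition bottom_rel (i q p : nat) : bool * bool * bool * bool :=
  (q == p, q %% 7 == p %% 7,
   [&& i == 4, 0 < q %% 7, 0 < p %% 7 & side q == side p],
   (i == 2) && (q %% 7 + p %% 7 == 9)%N).

(** A single word must explain all images at once, so the points [qs] already fixed restrict the
    word that may move [q]. *)
Definition top_ok (j : nat) (qs : seq nat) (q w : nat) : bool :=
  if in_top j q then
    has (fun t => all (fun x => in_top j x ==> (word_mv t x == x)) qs
                  && (word_mv t q == w)) (top_words j)
  else ~~ in_top j w && ((j < 4) || ((q < 7) == (w < 7))).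

(* The images of [q] not excluded by the invariants, for a permutation fixing [qs]. *)
Definition admissible j i qs q w : bool :=
  [&& bottom_ok i q w,
      all (fun x => bottom_rel i x q == bottom_rel i x w) qs & top_ok j qs q w].

(** A certificate in the style of Schreier and Sims: each word of a walk fixes the earlier base
    points and uses only letters from [j] to [i], and every admissible image of [q] occurs on the
    walk. Two points may be left over, since parity settles them. *)
Fixpoint check_chain (j i : nat) (qs : seq nat)
    (st : seq (nat * seq (seq nat))) : bool :=
  if st is (q, ws) :: st' then
    [&& q < 14,
        all (fun u => all (fun l => (0 < l) && (j <= l <= i)) u
                      && all (fun x => word_mv u x == x) qs) ws,
        all (fun w => admissible j i qs q w ==>
                      (w \in q :: scanl (fun x u => word_mv u x) q ws)) (iota 0 14)
      & check_chain j i (q :: qs) st']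
  else size [seq q <- iota 0 14 | q \notin qs] <= 2.

Lemma check_chain_nil j i qs :
  check_chain j i qs [::] = (size [seq q <- iota 0 14 | q \notin qs] <= 2).
Proof. by []. Qed.

Lemma check_chain_cons j i qs q ws st : check_chain j i qs ((q, ws) :: st) =
  [&& q < 14,
      all (fun u => all (fun l => (0 < l) && (j <= l <= i)) u
                    && all (fun x => word_mv u x == x) qs) ws,
      all (fun w => admissible j i qs q w ==>
                    (w \in q :: scanl (fun x u => word_mv u x) q ws)) (iota 0 14)
    & check_chain j i (q :: qs) st].
Proof. by []. Qed.

(** [flip4] times its conjugate by $\rho_{r-3}$: the flips of the blocks with indices 3, 4, 5, 6 and
    2, 4, 5, 6 combine to that of 2 and 3. Conjugated by the word 3, 2, 3, which moves index 2 to 4,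
    it flips 3 and 4; together with [flip4] this leaves the last two blocks. *)
Definition flip_bc : seq nat := flip4 ++ 3 :: flip4 ++ [:: 3].
Definition walk_word (l : nat) : seq nat :=
  nth [:: l] [:: flip4; [:: 1%N]; [:: 2]; [:: 3]; [:: 4]; [:: 5];
    flatten (nseq 3 [:: 3; 2]);
    flip4 ++ [:: 3; 2; 3] ++ flip_bc ++ [:: 3; 2; 3]] l.

(* For $\langle\rho_{r-i},\dots,\rho_{r-j}\rangle$: base points, each with a walk through
   its orbit under the stabiliser of the previous ones. In [walk_word], the letters 0, 6
   and 7 stand for: flip the last four blocks; exchange the last two; flip the last two. *)
Definition chain_table (j i : nat) : seq (nat * seq nat) := (
  match i, j with
  | 5, 5 => [:: (0, [:: 5])]
  | 5, 4 => [:: (0, [:: 5; 4]); (1, [:: 4]); (3, [:: 0])]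
  | 5, 3 => [:: (0, [:: 5; 4; 3; 4; 3; 4; 5]); (1, [:: 4; 3; 4; 3; 4]);
                (2, [:: 3; 0; 3]); (4, [:: 0])]
  | 5, 2 => [:: (0, [:: 5; 4; 3; 2; 4; 2; 3; 4; 5]); (1, [:: 4; 3; 2; 4; 2; 3; 4]);
                (2, [:: 3; 2; 0; 2; 3]); (3, [:: 2; 0; 2]); (5, [:: 6; 7; 6])]
  | 5, 1 => [:: (0, [:: 5; 4; 3; 2; 1; 2; 4; 2; 1; 2; 3; 4; 5]);
                (1, [:: 4; 3; 2; 1; 2; 4; 2; 1; 2; 3; 4]);
                (2, [:: 3; 2; 1; 2; 0; 2; 1; 2; 3]); (3, [:: 2; 1; 2; 0; 2; 1; 2]);
                (4, [:: 1; 6; 7; 6; 1]); (5, [:: 6; 7; 6])]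
  | 4, 4 => [:: (1, [:: 4])]
  | 4, 3 => [:: (1, [:: 4; 3; 4; 3; 4]); (2, [:: 3])]
  | 4, 2 => [:: (1, [:: 4; 3; 2; 4; 2; 3; 4]); (2, [:: 3; 2]); (3, [:: 2]); (5, [:: 6])]
  | 4, 1 => [:: (1, [:: 4; 3; 2; 1; 2; 4; 2; 1; 2; 3; 4]); (2, [:: 3; 2; 1; 2]);
                (3, [:: 2; 1; 2]); (4, [:: 1; 6]); (5, [:: 6])]
  | 3, 3 => [:: (2, [:: 3])]
  | 3, 2 => [:: (2, [:: 3; 2]); (3, [:: 2]); (5, [:: 6])]
  | 3, 1 => [:: (2, [:: 3; 2; 1; 2]); (3, [:: 2; 1; 2]); (4, [:: 1; 6]); (5, [:: 6])]
  | 2, 2 => [:: (3, [:: 2])]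
  | 2, 1 => [:: (3, [:: 2; 1; 2]); (4, [:: 1])]
  | 1, 1 => [:: (4, [:: 1])]
  | _, _ => [::]
  end)%N.

(* Points whose image is only determined by parity. *)
Definition parity_points (j i : nat) : seq nat :=
  match i, j with
  | 5, 3 => [:: 3; 10] | 5, 2 => [:: 4; 11] | 5, 1 => [:: 6; 13] | _, _ => [::]
  end.

(** After the base points, every point except the parity points is listed with an empty walk: the
    check then demands that the invariants alone force it to be fixed. *)
Definition chain (j i : nat) : seq (nat * seq (seq nat)) :=
  [seq (p.1, map walk_word p.2) | p <- chain_table j i] ++
  [seq (q, [::]) | q <- iota 0 14 & q \notin parity_points j i].

Lemma check_chain_all :
  all (fun i => all (fun j => check_chain j i [::] (chain j i)) (iota 1 6)) (iota 1 5).
Proof. by vm_compute. Qed.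

Lemma bottom_rel_mv i l q p : 0 < l <= i -> i <= 5 -> q < 14 -> p < 14 ->
  bottom_rel i (top_mv l q) (top_mv l p) = bottom_rel i q p.
Proof.
have /allP H : all (fun i => all (fun l => all (fun q => all (fun p =>
    (l <= i) ==> (bottom_rel i (top_mv l q) (top_mv l p) == bottom_rel i q p))
    (iota 0 14)) (iota 0 14)) (iota 1 5)) (iota 1 5) by vm_compute.
move=> hl hi hq hp; have := H i; rewrite mem_iota => /(_ _)/allP/(_ l).
rewrite mem_iota => /(_ _ _)/allP/(_ q); rewrite mem_iota => /(_ _ _ _)/allP/(_ p).
by rewrite mem_iota (andP hl).2 => E; apply/eqP/E; lia.
Qed.

Lemma bottom_ok_mv i l q w : 0 < l <= i -> i <= 5 -> q < 14 -> w < 14 ->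
  bottom_ok i q w -> bottom_ok i q (top_mv l w).
Proof.
have /allP H : all (fun i => all (fun l => all (fun q => all (fun w =>
    (l <= i) ==> bottom_ok i q w ==> bottom_ok i q (top_mv l w))
    (iota 0 14)) (iota 0 14)) (iota 1 5)) (iota 1 5) by vm_compute.
move=> hl hi hq hp ok; have := H i; rewrite mem_iota => /(_ _)/allP/(_ l).
rewrite mem_iota => /(_ _ _)/allP/(_ q); rewrite mem_iota => /(_ _ _ _)/allP/(_ w).
by rewrite mem_iota (andP hl).2 ok => E; apply/E; lia.
Qed.

Lemma bottom_refl i q : bottom_ok i q q.
Proof. by rewrite /bottom_ok; case: ifP => // ->; rewrite !eqxx orbT. Qed.

(** Closure of the words, as maps on the top points, under right multiplication by $\rho_{r-l}$. *)
Lemma top_words_mv j l t : 0 < j <= 5 -> j <= l <= 5 -> t \in top_words j ->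
  exists2 t', t' \in top_words j &
    forall q, q < 14 -> in_top j q -> top_mv l (word_mv t q) = word_mv t' q.
Proof.
have /allP H : all (fun j => all (fun l => all (fun t =>
    (j <= l) ==> has (fun t' => all (fun q => in_top j q ==>
       (top_mv l (word_mv t q) == word_mv t' q)) (iota 0 14)) (top_words j))
   (top_words j)) (iota 1 5)) (iota 1 5) by vm_compute.
move=> hj hl ht; have := H j; rewrite mem_iota => /(_ _)/allP/(_ l).
rewrite mem_iota => /(_ _ _)/allP/(_ t ht); rewrite (andP hl).1 => /(_ _ _)/hasP.
case; [lia | lia | move=> t' t'V /allP E; exists t' => // q hq top].
by have := E q; rewrite mem_iota top => /(_ _)/eqP; apply; lia.
Qed.

Lemma top_words_perm j t q : 0 < j <= 6 -> t \in top_words j -> q < 14 -> in_top j q ->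
  [/\ word_mv t q < 14, in_top j (word_mv t q) &
      exists2 q', q' < 14 /\ in_top j q' & word_mv t q' = q].
Proof.
have /allP H : all (fun j => all (fun t => all (fun q => in_top j q ==>
    [&& word_mv t q < 14, in_top j (word_mv t q) &
      has (fun q' => in_top j q' && (word_mv t q' == q)) (iota 0 14)])
   (iota 0 14)) (top_words j)) (iota 1 6) by vm_compute.
move=> hj ht hq top; have := H j; rewrite mem_iota => /(_ _)/allP/(_ t ht)/allP/(_ q).
rewrite mem_iota hq top => /(_ _ isT)/and3P[]; first by lia.
move=> h1 h2 /hasP[q' ]; rewrite mem_iota => hq' /andP[top' /eqP e].
by split=> //; exists q'.
Qed.

Lemma top_words_invol j t q : 0 < j <= 5 -> t \in top_words j -> q < 14 -> in_top j q ->
  word_mv t (word_mv t q) = q.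
Proof.
have /allP H : all (fun j => all (fun t => all (fun q => in_top j q ==>
    (word_mv t (word_mv t q) == q)) (iota 0 14)) (top_words j)) (iota 1 5) by vm_compute.
move=> hj ht hq top; have /H/allP/(_ t ht)/allP : j \in iota 1 5 by rewrite mem_iota; lia.
by move/(_ q); rewrite mem_iota hq top => /(_ isT)/eqP.
Qed.

Lemma top_words_letters j t : 0 < j <= 5 -> t \in top_words j ->
  all (fun l => j <= l <= 5) t.
Proof.
have /allP H : all (fun j => all (all (fun l => j <= l <= 5)) (top_words j)) (iota 1 5).
  by vm_compute.
by move=> hj; apply/allP/H; rewrite mem_iota; lia.
Qed.

(** This holds for [flip4] but not for the single letter 4, which acts in the same way on the top
    points but also moves the blocks with indices 1 and 2. *)
Lemma top_words4 t q : t \in top_words 4 -> q < 14 -> ~~ in_top 4 q -> word_mv t q = q.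
Proof.
have /allP H : all (fun t => all (fun q => ~~ in_top 4 q ==> (word_mv t q == q))
   (iota 0 14)) (top_words 4) by vm_compute.
by move=> /H/allP/(_ q); rewrite mem_iota => {}H hq top; apply/eqP/(implyP (H hq)).
Qed.

Lemma word_mv_lt w q : q < 14 -> word_mv w q < 14.
Proof.
have mv_lt l x : x < 14 -> top_mv l x < 14.
  (* Letters from 6 on hit the default of [nth], an empty list of transpositions. *)
  move=> hx; case: (ltnP l 6) => hl; last first.
    by rewrite /top_mv /involution_of nth_default.
  have /allP H : all (fun l => all (fun x => top_mv l x < 14) (iota 0 14)) (iota 0 6).
    by vm_compute.
  by have := H l; rewrite mem_iota => /(_ hl)/allP/(_ x); rewrite mem_iota => /(_ hx).
by elim: w q => //= l w IHw q hq; apply/IHw/mv_lt.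
Qed.

(** If one of the two exceptional points moved, [s] would be their transposition, which is odd. Here
    [a] and [b] are plain numbers, possibly equal, so default values may be passed for them. *)
Lemma even_fix_but_two n (s : {perm 'I_n}) a b : ~~ odd_perm s ->
  (forall i, i < n -> i != a -> i != b -> ev s i = i) -> s = 1.
Proof.
move=> ev_s fix_s; apply: eq_ev => i lin; rewrite ev1.
have key c d : (forall i, i < n -> i != c -> i != d -> ev s i = i) -> c < n -> ev s c = c.
  move=> fix_cd cn; apply/eqP/negPn/negP => nc; have inj := @ev_inj _ s.
  have sc : ev s c = d.
    apply/eqP/negPn/negP => nd; have := ev_lt s cn; move=> /fix_cd/(_ nc nd)/inj.
    by move/eqP: nc.
  have dn : d < n by rewrite -sc ev_lt.
  have sd : ev s d = c.
    apply/eqP/negPn/negP => sdc; case: (eqVneq (ev s d) d) => [e|sdd].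
      by move/eqP: nc; apply; rewrite sc; apply: inj; rewrite e.
    by have := ev_lt s dn; move=> /fix_cd/(_ sdc sdd)/inj/eqP; rewrite (negPf sdd).
  suff def_s : s = tp n c d.
    move: ev_s; rewrite def_s; case: (ltngtP c d) => [cd|dc|e].
    - by rewrite odd_tp ?cd.
    - suff -> : tp n c d = tp n d c by rewrite odd_tp ?dc.
      by apply: eq_ev => x _; rewrite !ev_tp //; clear -dc; ifs.
    - by move: nc; rewrite sc e eqxx.
  apply: eq_ev => x xn; rewrite ev_tp //.
  by case: eqVneq => [->//|xc]; case: eqVneq => [->//|xd]; rewrite fix_cd.
case: (eqVneq i a) => [e|ia]; first by rewrite e; apply: (key a b) => //; rewrite -e.
case: (eqVneq i b) => [e|ib]; last exact: fix_s.
move: lin; rewrite e => bn; apply: (key b a) => // x xn xb xa; exact: fix_s.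
Qed.

Lemma pt_inj r q p : 8 <= r -> q < 14 -> p < 14 -> pt r q = pt r p -> q = p.
Proof. by move=> r8 hq hp; rewrite /pt; ifs. Qed.

(** * Invariants of the two groups, and the case $k\ge r-5$ *)

Section Invariants.
Variables n r : nat.
Hypotheses (r8 : 8 <= r) (En : n = r.*2.+3).

Local Notation H := (fun i j => gen_by (rho n) (itv r i j)).

(** The ranges of $m$ overlap. For $m\le r-4$ the set of the $p$'s and $y_j$, $j\le m+1$, and the
    set of the $z_j$, $j\le m+1$, are preserved; beyond them the action is given by [top_words] if
    $m\ge r-5$, and is trivial if $m\le r-6$. *)
Definition top_inv (m : nat) (s : {perm 'I_n}) : Prop :=
  [/\ m + 4 <= r -> forall x, (x <= m + 3 -> ev s x <= m + 3)
        /\ (r + 4 <= x <= r + m + 2 -> r + 4 <= ev s x <= r + m + 2),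
      r <= m + 5 -> exists2 t, t \in top_words (r - m) &
        forall q, q < 14 -> in_top (r - m) q -> ev s (pt r q) = pt r (word_mv t q)
    & m + 5 < r -> forall x, (m + 4 <= x <= r + 3) || (r + m + 3 <= x) -> ev s x = x].

Definition bottom_inv (i : nat) (s : {perm 'I_n}) : Prop :=
  (forall x, (forall q, q < 14 -> x != pt r q) -> ev s x = x) /\
  exists f : nat -> nat,
    [/\ forall q, q < 14 -> f q < 14 /\ ev s (pt r q) = pt r (f q),
        forall q, q < 14 -> bottom_ok i q (f q)
      & forall q p, q < 14 -> p < 14 -> bottom_rel i (f q) (f p) = bottom_rel i q p].

Lemma top_inv1 m : m < r -> top_inv m 1.
Proof.
move=> m_lt; split=> [_ x|mr|_ x _]; rewrite ?ev1 //.
exists [::]; last by move=> q _ _; rewrite ev1.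
have {m_lt mr} : 0 < r - m <= 5 by lia.
by case: (r - m) => [|[|[|[|[|[|l]]]]]].
Qed.

Lemma top_inv_rho m k s : 3 <= m < r -> k <= m -> top_inv m s -> top_inv m (s * rho n k).
Proof.
case/andP=> m3 mr km [sc st sf]; have kr := leq_ltn_trans km mr.
have E i : ev (s * rho n k) i = mv r k (ev s i) by rewrite evM (ev_rho _ r8 En kr).
split=> [m4 x|m5|m5 x hx]; rewrite ?E.
- have [h1 h2] := sc m4 x; move: (ev s x) h1 h2 => u h1 h2.
  by split=> [/h1|/h2]; clear -r8 m3 km m4; rewrite /mv; ifs.
- have [t tV ht] := st m5; have j6 : 0 < r - m <= 6 by clear -mr m5; lia.
  case: (leqP r (k + 5)) => k5; last first.
    exists t => // q hq top; rewrite E ht //.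
    have [h1 h2 _] := top_words_perm j6 tV hq top.
    move: (word_mv t q) h1 h2 => u u14; rewrite /in_top => /andP[_ hu].
    (* $\rho_{r-6}$ still moves the points with indices 0 and 7, but these are never among the top
       points. *)
    have {}hu : 0 < u %% 7 := leq_ltn_trans (leq0n _) hu.
    have {}hu : u != 0%N /\ u != 7 by split; apply: contraTneq hu => ->.
    by clear -hu u14 k5 r8; rewrite /mv /pt; ifs.
  have [||t' t'V ht'] := @top_words_mv (r - m) (r - k) t _ _ tV.
  + by clear -mr m5; lia.
  + by clear -mr km k5 m5; lia.
  exists t' => // q hq top; rewrite E ht // -ht' //.
  rewrite -mv_pt ?word_mv_lt //; last by clear -kr k5; lia.
  by congr mv; clear -kr; lia.
- by rewrite sf //; clear -r8 m3 km m5 hx; rewrite /mv; ifs.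
Qed.

Lemma bottom_inv1 i : bottom_inv i 1.
Proof.
split=> [x _|]; first exact: ev1.
by exists id; split=> // q hq; rewrite ?ev1 ?bottom_refl.
Qed.

Lemma bottom_inv_rho i k s : i <= 5 -> k < r -> r - i <= k ->
  bottom_inv i s -> bottom_inv i (s * rho n k).
Proof.
move=> i5 kr ik [s_fix [f [sf fok frel]]].
have E x : ev (s * rho n k) x = mv r k (ev s x) by rewrite evM (ev_rho _ r8 En kr).
have Ek : k = r - (r - k) by clear -kr; lia.
have l5 : 0 < r - k <= 5 by clear -kr ik i5 r8; lia.
have li : 0 < r - k <= i by clear -kr ik i5 r8; lia.
have mv_lt q : q < 14 -> top_mv (r - k) q < 14 by exact: (@word_mv_lt [:: r - k]).
split=> [x nx|]; first by rewrite E s_fix // Ek mv_not_pt.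
exists (fun q => top_mv (r - k) (f q)); split=> [q hq|q hq|q p hq hp].
- by have [f14 e] := sf q hq; rewrite mv_lt // E e {1}Ek mv_pt.
- by apply: bottom_ok_mv => //; [case: (sf q hq) | apply: fok].
- by rewrite bottom_rel_mv ?frel //; [case: (sf q hq) | case: (sf p hp)].
Qed.

Definition fixes (qs : seq nat) (s : {perm 'I_n}) : Prop :=
  forall q, q \in qs -> ev s (pt r q) = pt r q.

Lemma ev_word (w : seq nat) q : all (fun l => 0 < l <= 5) w -> q < 14 ->
  ev (\prod_(l <- w) rho n (r - l)) (pt r q) = pt r (word_mv w q).
Proof.
elim: w q => [|l w IHw] q /=; first by rewrite big_nil ev1.
case/andP=> l5 w5 hq; rewrite big_cons evM (ev_rho _ r8 En); last by clear -r8 l5; lia.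
by rewrite mv_pt // IHw //; apply: (@word_mv_lt [:: l]).
Qed.

Section BaseCase.
Variables (m k : nat).
Hypotheses (m3 : 3 <= m < r) (k5 : k < r <= k + 5).
Let j := minn (r - m) 6.
Let i := r - k.

(** [h] is the product of the words of an initial piece of the walk. Letters from [j] to [i] are
    labels from [k] to [m]; when $m\le r-6$ the cut [j = 6] leaves no letter at all. *)
Lemma chain_scan qs q ws w : all (fun x => x < 14) qs -> q < 14 ->
  all (fun u => all (fun l => (0 < l) && (j <= l <= i)) u
                && all (fun x => word_mv u x == x) qs) ws ->
  w \in q :: scanl (fun x u => word_mv u x) q ws ->
  exists h, [/\ h \in H k m.+1, fixes qs h & ev h (pt r q) = pt r w].
Proof.
move=> qs14; elim: ws q => [|u ws IHws] q hq.
  rewrite mem_seq1 => _ /eqP->; exists 1; split; rewrite ?group1 ?ev1 //.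
  by move=> x _; rewrite ev1.
rewrite [all _ _]/= => /andP[/andP[u_ok /allP u_fix] ws_ok].
rewrite [scanl _ _ _]/= inE => /predU1P[->|hw].
  by exists 1; split; rewrite ?group1 ?ev1 // => x _; rewrite ev1.
have [h [hH h_fix hq']] := IHws _ (word_mv_lt u hq) ws_ok hw.
have u5 : all (fun l => 0 < l <= 5) u.
  by apply: sub_all u_ok => l; rewrite /i /j; clear -k5; lia.
exists (\prod_(l <- u) rho n (r - l) * h); split.
- rewrite groupM // big_seq; apply: group_prod => l /(allP u_ok) hl.
  by apply: mem_gen_itv; move: hl; rewrite /i /j; clear -m3 k5; lia.
- move=> x xqs; rewrite evM ev_word ?(allP qs14) //.
  by rewrite (eqP (u_fix x xqs)) h_fix.
- by rewrite evM ev_word.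
Qed.
Lemma top_ok_inv qs s q w : top_inv m s -> all (fun x => x < 14) qs -> fixes qs s ->
  q < 14 -> w < 14 -> ev s (pt r q) = pt r w -> top_ok j qs q w.
Proof.
move=> [sc st sf] /allP qs14 s_fix hq hw sq; have inj := pt_inj r8.
case: (leqP r (m + 5)) => m5; last first.
  have -> : j = 6 by rewrite /j; clear -m5; lia.
  have s_top x : x < 14 -> in_top 6 x -> ev s (pt r x) = pt r x.
    move=> x14 /andP[_ hx]; apply: (sf m5).
    by clear -m3 r8 m5 hx x14; rewrite /pt; ifs.
  rewrite /top_ok; case: ifP => top.
    apply/hasP; exists [::] => //=; apply/andP; split.
      by apply/allP=> x _; rewrite eqxx implybT.
    by apply/eqP/inj => //; rewrite -sq s_top.
  have ntop : ~~ in_top 6 w.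
    apply: contraFN top => topw; suff <- : w = q by [].
    by apply: inj => //; apply: (@ev_inj _ s); rewrite s_top.
  rewrite ntop /=; apply/eqP; have := sf m5 (pt r q).
  have m4 : m + 4 <= r by clear -m5; lia.
  have [] := sc m4 (pt r q); rewrite sq.
  move: top ntop; rewrite /in_top /= => /negbT top ntop.
  by clear -r8 m3 m5 top ntop hq hw; rewrite /pt; ifs.
have -> : j = r - m by rewrite /j; clear -m5; lia.
have [t tV ht] := st m5; have j6 : 0 < r - m <= 6 by clear -m3 m5; lia.
rewrite /top_ok; case: ifP => top.
  apply/hasP; exists t => //; apply/andP; split.
    apply/allP=> x xqs; apply/implyP=> topx; apply/eqP/inj; rewrite ?word_mv_lt ?qs14 //.
    by rewrite -ht ?qs14 ?s_fix.
  by apply/eqP/inj; rewrite ?word_mv_lt // -ht.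
have ntop : ~~ in_top (r - m) w.
  apply: contraFN top => topw.
  have [_ _ [q' [hq' top'] e]] := top_words_perm j6 tV hw topw.
  suff <- : q' = q by [].
  by apply: inj => //; apply: (@ev_inj _ s); rewrite ht // e.
rewrite ntop /=; case: ltnP => //= j4; apply/eqP.
have m4 : m + 4 <= r by clear -j4 m3; lia.
have [] := sc m4 (pt r q); rewrite sq.
move: top ntop; rewrite /in_top => /negbT top ntop.
by clear -r8 m3 m5 j4 top ntop hq hw; rewrite /pt; ifs.
Qed.

Lemma chain_sound qs st s : all (fun x => x < 14) qs -> check_chain j i qs st ->
  top_inv m s -> bottom_inv i s -> ~~ odd_perm s -> fixes qs s -> s \in H k m.+1.
Proof.
elim: st qs s => [|[q ws] st IHst] qs s /allP qs14.
  rewrite check_chain_nil => left2 _ [s_np _] s_even s_fix.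
  set L := [seq _ <- _ | _] in left2.
  suff -> : s = 1 by rewrite group1.
  (* [L] has at most two entries; where one is missing, the default index 0 merely names a further
     permitted exception. *)
  apply: (@even_fix_but_two _ _ (pt r (nth 0 L 0)) (pt r (nth 0 L 1))) => // x xn xa xb.
  case: (boolP (has (fun q => x == pt r q) (iota 0 14))) => [|/hasPn np]; last first.
    by apply: s_np => q hq; apply: np; rewrite mem_iota.
  case/hasP=> q; rewrite mem_iota => hq /eqP def_x; rewrite def_x.
  apply: s_fix; apply: contraT => nq; have : q \in L by rewrite mem_filter nq mem_iota.
  move: xa xb left2; rewrite def_x; case: (L) => [|a [|b []]] //= xa xb _; rewrite !inE.
    by move/eqP=> e; rewrite e eqxx in xa.
  by case/orP=> /eqP e; [rewrite e eqxx in xa | rewrite e eqxx in xb].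
rewrite check_chain_cons => /and4P[hq ws_ok /allP adm st_ok] topI botI s_even s_fix.
have [_ [f [sf fok frel]]] := botI; have [fq14 sq] := sf q hq.
have inj := pt_inj r8.
have wadm : admissible j i qs q (f q).
  rewrite /admissible fok //= (@top_ok_inv qs s) ?andbT //; last exact/allP.
  apply/allP=> x xqs; have hx := qs14 x xqs; have [fx14 sx] := sf x hx.
  have {2}<- : f x = x by apply: inj => //; rewrite -sx s_fix.
  by rewrite frel.
have qs14' : all (fun x => x < 14) qs by apply/allP.
have := adm (f q); rewrite mem_iota wadm => /(_ fq14).
case/(chain_scan qs14' hq ws_ok)=> h [hH h_fix hqw].
have hV : h^-1 \in H k m.+1 by rewrite groupV.
rewrite -(groupMr _ hV); apply: (IHst (q :: qs)) => //.
- by apply/allP=> x; rewrite inE => /predU1P[->//|/qs14].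
- apply: (gen_by_ind (P := top_inv m) _ hV topI) => t x; rewrite inE => /andP[_ xm].
  by apply: top_inv_rho; rewrite // -ltnS.
- apply: (gen_by_ind (P := bottom_inv i) _ hV botI) => t x; rewrite inE => /andP[kx _].
  by apply: bottom_inv_rho; rewrite ?ltn_ord // /i; clear -k5 kx; lia.
- rewrite odd_permM odd_permV (negPf s_even) /=.
  have : ~~ odd_perm (1 * h); last by rewrite mul1g.
  apply: (gen_by_ind (P := fun t => ~~ odd_perm t) _ hH) => [|]; last by rewrite odd_perm1.
  by move=> t x _; rewrite odd_permM (even_rho _ r8 En) addbF.
- move=> x; rewrite inE evM => /predU1P[->|xqs].
    by rewrite sq -hqw evK.
  by rewrite s_fix // -{1}(h_fix x xqs) evK.
Qed.

Lemma base_case s : top_inv m s -> bottom_inv i s -> ~~ odd_perm s -> s \in H k m.+1.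
Proof.
move=> topI botI s_even; apply: (@chain_sound [::] (chain j i)) => //.
have /allP chk := check_chain_all.
have /chk/allP : i \in iota 1 5 by rewrite mem_iota /i; clear -k5; lia.
by apply; rewrite mem_iota /j; clear -m3; lia.
Qed.
End BaseCase.
End Invariants.

(** * Blocks, and the case $3\le k\le r-5$ *)

Definition partner (r u v : nat) : bool :=
  ((4 < u <= r + 3) && (v == u + (r - 1))%N) || ((4 < v <= r + 3) && (u == v + (r - 1))%N).

Lemma partner_mv r k u v : 8 <= r -> 2 < k < r -> partner r u v ->
  partner r (mv r k u) (mv r k v).
Proof.
move=> r8 hk; rewrite /partner => huv.
have [w [hw e]] : exists w, 4 < w <= r + 3 /\
    (u = w /\ v = (w + (r - 1))%N \/ v = w /\ u = (w + (r - 1))%N).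
  by case/orP: huv => /andP[h /eqP->]; [exists u | exists v]; tauto.
have E : mv r k (w + (r - 1))%N = (mv r k w + (r - 1))%N /\ 4 < mv r k w <= r + 3 \/
         mv r k w = (mv r k (w + (r - 1)) + (r - 1))%N /\
         4 < mv r k (w + (r - 1)) <= r + 3.
  by clear -r8 hk hw; rewrite /mv; ifs.
by move: E; case: e => [][-> ->]; move: (mv r k w) (mv r k _) => a b; clear; lia.
Qed.

Section BlockInvariant.
Variables n r : nat.
Hypotheses (r8 : 8 <= r) (En : n = r.*2.+3).

Local Notation H := (fun i j => gen_by (rho n) (itv r i j)).

Lemma even_gen (J : {set 'I_r}) h : h \in gen_by (rho n) J -> ~~ odd_perm h.
Proof.
move=> hJ; have : ~~ odd_perm (1 * h); last by rewrite mul1g.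
apply: (gen_by_ind (P := fun t => ~~ odd_perm t) _ hJ) => [|]; last by rewrite odd_perm1.
by move=> t x _; rewrite odd_permM (even_rho _ r8 En) addbF.
Qed.

(** The bounds $k+1$ and $r+k$ are $y_{k-1}$ and $z_{k-1}$. *)
Definition block_inv (k : nat) (s : {perm 'I_n}) : Prop :=
  (forall x, (x <= k + 1) || (r + 4 <= x <= r + k) -> ev s x = x) /\
  (forall x, 4 < x <= r + 3 -> partner r (ev s x) (ev s (x + (r - 1))%N)).

Lemma block_inv1 k : block_inv k 1.
Proof.
split=> x hx; rewrite !ev1 // /partner; apply/orP; left.
by rewrite hx eqxx.
Qed.

Lemma block_inv_rho k l s : 3 <= k <= l -> l < r -> block_inv k s ->
  block_inv k (s * rho n l).
Proof.
move=> /andP[k3 kl] lr [s_fix s_bl].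
have E x : ev (s * rho n l) x = mv r l (ev s x) by rewrite evM (ev_rho _ r8 En lr).
split=> x hx; rewrite !E.
  by rewrite s_fix //; clear -r8 k3 kl lr hx; rewrite /mv; ifs.
by apply: partner_mv (s_bl x hx); rewrite // lr (leq_trans k3 kl).
Qed.

Lemma block_inv_moved k s x : block_inv k s -> x < n ->
  (k + 2 <= x <= r + 3) || (r + k + 1 <= x) ->
  (k + 2 <= ev s x <= r + 3) || (r + k + 1 <= ev s x < n).
Proof.
move=> [s_fix _] xn hx; have := ev_lt s xn; rewrite {2}En => yn.
apply: contraT => hy; have sy : ev s (ev s x) = ev s x.
  by apply: s_fix; move: (ev s x) yn hy => y; rewrite En; clear; lia.
have e := ev_inj sy; move: hy; rewrite e En; move: xn hx; rewrite En; clear; lia.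
Qed.

(** With [i = 5], [bottom_ok] always holds and the last two components of [bottom_rel] are false, so
    injectivity and the pairing into blocks suffice. *)
Lemma bottom_inv_block s : block_inv (r - 5) s -> bottom_inv r 5 s.
Proof.
move=> bl; have [s_fix s_bl] := bl.
have moved q (hq : q < 14) : (r - 3 <= ev s (pt r q) <= r + 3)
    || (r.*2 - 4 <= ev s (pt r q) < r.*2.+3).
  have := @block_inv_moved _ _ (pt r q) bl.
  move: (ev s _) => y; rewrite En; move: (hq); clear -r8 hq => hq' /(_ _ _) P.
  have : (r - 5 + 2 <= y <= r + 3) || (r + (r - 5) + 1 <= y < r.*2.+3).
    by apply: P; rewrite /pt; ifs.
  by clear -r8; lia.
split=> [x xnp|].
  case: (ltnP x n) => xn; last exact: ev_out.
  apply: s_fix; apply: contraT => hx; exfalso.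
  move: xn hx; rewrite En => xn hx; case: (leqP x (r + 3)) => hx3.
    have /eqP[] : x != pt r (x - (r - 3)) by apply: xnp; clear -hx hx3; lia.
    by clear -r8 hx hx3; rewrite /pt; ifs.
  have /eqP[] : x != pt r (x - (r.*2 - 4) + 7) by apply: xnp; clear -xn hx3 hx r8; lia.
  by clear -r8 xn hx hx3; rewrite /pt; ifs.
pose f q := let u := ev s (pt r q) in
  (if u <= r + 3 then u - (r - 3) else u - (r.*2 - 4) + 7)%N.
have f_spec q : q < 14 -> f q < 14 /\ ev s (pt r q) = pt r (f q).
  by move/moved; rewrite /f; move: (ev s _) => y; clear -r8; rewrite /pt; ifs.
have inj := pt_inj r8.
have f_inj q p : q < 14 -> p < 14 -> (f q == f p) = (q == p).
  move=> hq hp; apply/eqP/eqP => [e|->//]; apply: inj => //.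
  by apply: (@ev_inj _ s); rewrite !(f_spec _ _).2 // e.
pose opp q := (if q < 7 then q + 7 else q - 7)%N.
have oppE q p : q < 14 -> p < 14 -> (q %% 7 == p %% 7) = (q == p) || (opp q == p).
  by rewrite /opp; clear => hq hp; ifs.
have opp14 q : q < 14 -> opp q < 14 by rewrite /opp; clear; ifs.
have f_opp q : q < 14 -> f (opp q) = opp (f q).
  have key p : p < 7 -> f (p + 7)%N = opp (f p).
    move=> hp; have [|f1 e1] := f_spec p; first by clear -hp; lia.
    have [|f2 e2] := f_spec (p + 7)%N; first by clear -hp; lia.
    have := s_bl (pt r p); rewrite e1 (_ : (pt r p + (r - 1))%N = pt r (p + 7)); last first.
      by clear -hp r8; rewrite /pt; ifs.
    rewrite e2 => /(_ _) P; have {P} : partner r (pt r (f p)) (pt r (f (p + 7)%N)).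
      by apply: P; clear -hp r8; rewrite /pt; ifs.
    move: (f p) (f _) f1 f2 => a b; clear -r8 => ha hb.
    by rewrite /partner /opp /pt; ifs.
  move=> hq; rewrite {1}/opp; case: ltnP => q7; first exact: key.
  have := key (q - 7)%N; rewrite subnK // => ->; last by clear -hq q7; lia.
  have [|f1 _] := f_spec (q - 7)%N; first by clear -hq; lia.
  by move: (f _) f1 => a; clear; rewrite /opp; ifs.
exists f; split=> // q p hq hp.
have [fq _] := f_spec q hq; have [fp _] := f_spec p hp.
rewrite /bottom_rel f_inj // oppE // f_inj // -f_opp // f_inj ?opp14 //.
by rewrite -oppE.
Qed.

(** For $m\ge r-3$, these are the points of the graph not governed by [top_words (r - m)]. *)
Definition free (m x : nat) : bool :=
  [|| r <= m + 1, x <= m + 3 | r + 4 <= x <= r + m + 2].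

Lemma top_inv_free m (s : {perm 'I_n}) x : m < r <= m + 3 -> top_inv r m s -> x < n -> free m x ->
  free m (ev s x).
Proof.
move=> hm [_ st _] xn xfree; apply: contraT => nfree.
have [t tV ht] : exists2 t, t \in top_words (r - m) &
    forall q, q < 14 -> in_top (r - m) q -> ev s (pt r q) = pt r (word_mv t q).
  by apply: st; clear -hm; lia.
have := ev_lt s xn; rewrite {2}En => yn.
pose q := (if ev s x <= r + 3 then ev s x - (r - 3) else ev s x - (r.*2 - 4) + 7)%N.
have [q14 topq def_y] : [/\ q < 14, in_top (r - m) q & ev s x = pt r q].
  move: nfree yn; rewrite /free /q /in_top; move: (ev s x) => y; clear -r8 hm => h1 h2.
  by split; rewrite /pt; ifs.
have [|_ _ [q' [hq' top'] e]] := @top_words_perm (r - m) t q _ tV q14 topq.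
  by clear -hm; lia.
have def_x : x = pt r q' by apply: (@ev_inj _ s); rewrite ht // e.
move: xfree top'; rewrite def_x /free /in_top; clear -r8 hm hq'.
by rewrite /pt; ifs.
Qed.

Lemma reach_step k m x y l : k <= l <= m -> l < r -> mv r l x = y ->
  (exists2 h, h \in H k m.+1 & ev h (k + 2)%N = x) ->
  exists2 h, h \in H k m.+1 & ev h (k + 2)%N = y.
Proof.
move=> hl lr def_y [h hH def_x]; exists (h * rho n l).
  by rewrite groupM // mem_gen_itv // ltnS.
by rewrite evM (ev_rho _ r8 En lr) def_x.
Qed.

Lemma reach_y k m x : 3 <= k -> m < r -> k + 2 <= x <= m + 3 ->
  exists2 h, h \in H k m.+1 & ev h (k + 2)%N = x.
Proof.
move=> k3 mr; elim: x => [|x IHx] hx; first by clear -hx; lia.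
case: (ltnP x (k + 2)) => xk.
  by exists 1; rewrite ?group1 // ev1; clear -hx xk; lia.
apply: (@reach_step _ _ x _ (x - 2)).
- by clear -hx xk; lia.
- by clear -hx mr; lia.
- by clear -xk k3 r8; rewrite /mv; ifs.
- by apply: IHx; clear -hx xk; lia.
Qed.

(** The walk climbs the $y$'s, crosses an edge $\{y_j,z_j\}$ by the label $r-4$, which lies strictly
    between $k$ and $m$, and descends the $z$'s from $z_{r-2}$. The vertex $y_{r+1}$ hangs on $y_r$
    by the label $r-2$ and needs $m=r-1$. *)
Lemma reach_free k m x : 3 <= k <= r - 5 -> m < r <= m + 3 -> k + 2 <= x < n ->
  free m x -> (x <= r + 3) || (r + k + 1 <= x) ->
  exists2 h, h \in H k m.+1 & ev h (k + 2)%N = x.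
Proof.
case/andP=> k3 k5 hm hx fx hx2; have mr : m < r by case/andP: hm.
have y_ok u : u <= m + 3 -> k + 2 <= u ->
    exists2 h, h \in H k m.+1 & ev h (k + 2)%N = u.
  by move=> h1 h2; apply: reach_y; rewrite ?h2.
have y_last : m.+1 = r -> exists2 h, h \in H k m.+1 & ev h (k + 2)%N = (r + 3)%N.
  move=> em; apply: (@reach_step _ _ (r + 2) _ (r - 2)).
  - by clear -em k5 r8; lia.
  - by clear -r8; lia.
  - by clear -r8; rewrite /mv; ifs.
  - by apply: y_ok; clear -em k5; lia.
case: (leqP x (r + 3)) => [x_y|x_z].
  case: (leqP x (m + 3)) => [xm|xm]; first by apply: y_ok => //; case/andP: hx.
  have [em ->] : m.+1 = r /\ x = (r + 3)%N.
    by move: fx; rewrite /free; clear -x_y xm hm; lia.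
  exact: y_last.
have z_top u : r <= u <= r + 3 -> u <= m + 3 \/ m.+1 = r ->
    exists2 h, h \in H k m.+1 & ev h (k + 2)%N = (u + (r - 1))%N.
  move=> hu um; apply: (@reach_step _ _ u _ (r - 4)).
  - by clear -hm k5; lia.
  - by clear -r8; lia.
  - by clear -r8 hu; rewrite /mv; ifs.
  - case: (leqP u (m + 3)) => um3; first by apply: y_ok => //; clear -hu k5 k3; lia.
    by have -> : u = (r + 3)%N; [clear -hu um um3; lia | apply: y_last; clear -um um3; lia].
case: (leqP r.*2.-1 x) => xr.
  have := z_top (x - (r - 1))%N; rewrite subnK; last by clear -x_z; lia.
  apply; first by move: hx; rewrite En; clear -r8 xr; lia.
  by move: fx hx; rewrite /free En; clear -xr hm x_z; lia.
have z_low d : r + k + 1 <= (r.*2.-1 - d)%N ->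
    exists2 h, h \in H k m.+1 & ev h (k + 2)%N = (r.*2.-1 - d)%N.
  elim: d => [|d IHd] hd.
    have -> : (r.*2.-1 - 0)%N = (r + (r - 1))%N by clear -r8; lia.
    by apply: z_top; clear -hm r8; lia.
  apply: (@reach_step _ _ (r.*2.-1 - d) _ (r.*2.-1 - d.+1 - r - 1)).
  - by clear -hd hm; lia.
  - by clear -r8; lia.
  - by clear -r8 k3 hd; rewrite /mv; ifs.
  - by apply: IHd; clear -hd; lia.
have := z_low (r.*2.-1 - x)%N; rewrite subKn; last by clear -xr; lia.
by apply; clear -hx2 x_z; lia.
Qed.

(** Once $y_k$ is fixed, its partner $z_k$ is fixed too, because blocks are preserved; so one
    sifting step raises $k$ by one, down to the 14 points at $k=r-5$. *)
Lemma middle_case m k s : 3 <= m < r -> 3 <= k <= r - 5 -> top_inv r m s ->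
  block_inv k s -> ~~ odd_perm s -> s \in H k m.+1.
Proof.
move=> hm hk; have [d def_k] : exists d, k = (r - 5 - d)%N.
  by exists (r - 5 - k)%N; clear -hk; lia.
elim: d k def_k hk s => [|d IHd] k def_k hk s topI blI s_even.
  apply: base_case => //; first by clear -def_k r8; lia.
  have -> : (r - k)%N = 5 by clear -def_k r8; lia.
  by apply: bottom_inv_block; rewrite -(subn0 (r - 5)) -def_k.
have xn : k + 2 < n by rewrite En; clear -hk; lia.
have mvd : (k + 2 <= ev s (k + 2) <= r + 3) || (r + k + 1 <= ev s (k + 2)%N < n).
  by apply: (block_inv_moved blI xn); clear -hk; lia.
have [sc _ sf] := topI.
have [h hH def_h] : exists2 h, h \in H k m.+1 & ev h (k + 2)%N = ev s (k + 2)%N.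
  case: (ltnP m k) => mk.
    (* For $m+1<k$ the first group fixes $y_k$. For $m+1=k$ it cannot send $y_k$ beyond itself, and
       the second group cannot send it below. *)
    exists 1; rewrite ?group1 // ev1; apply/esym.
    case: (ltnP m.+1 k) => mk1.
      by apply: sf; clear -def_k hk r8 mk1; lia.
    have m4 : m + 4 <= r by clear -def_k hk mk1 mk r8; lia.
    have km : k + 2 <= m + 3 by clear -mk1; lia.
    have := (sc m4 (k + 2)%N).1 km; move: mvd; move: (ev s _) => y; clear -hk mk mk1 m4.
    by lia.
  case: (leqP r (m + 3)) => m3.
    apply: reach_free => //; first by clear -hm m3; lia.
    - by move: mvd; move: (ev s _) => y; rewrite En; clear -hk; lia.
    - apply: top_inv_free => //; first by clear -hm m3; lia.
      by rewrite /free; clear -mk; lia.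
    - by move: mvd; move: (ev s _) => y; clear; lia.
  have m4 : m + 4 <= r by clear -m3; lia.
  have km : k + 2 <= m + 3 by clear -mk; lia.
  apply: reach_y; [by case/andP: hk | by case/andP: hm | ].
  by have := (sc m4 (k + 2)%N).1 km; move: mvd; move: (ev s _) => y; clear -m3; lia.
have hV : h^-1 \in H k m.+1 by rewrite groupV.
rewrite -(groupMr _ hV).
have fix_y : ev (s * h^-1) (k + 2) = (k + 2)%N by rewrite evM -def_h evK.
have topI' : top_inv r m (s * h^-1).
  apply: (gen_by_ind (P := top_inv r m) _ hV topI) => t x; rewrite inE => /andP[_ xm].
  by apply: (top_inv_rho r8 En); rewrite // -ltnS.
have [fixI' blkI'] : block_inv k (s * h^-1).
  apply: (gen_by_ind (P := block_inv k) _ hV blI) => t x; rewrite inE => /andP[kx _].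
  by apply: block_inv_rho; rewrite ?ltn_ord // kx andbT; case/andP: hk.
have sub : H k.+1 m.+1 \subset H k m.+1.
  by apply/gen_byS/subsetP=> x; rewrite !inE; clear; lia.
apply: (subsetP sub); apply: IHd => //.
- by clear -def_k hk; lia.
- by clear -def_k hk; lia.
- split=> // x hx; case: (eqVneq x (k + 2)%N) => [->//|x1].
  case: (eqVneq x (r + k + 1)%N) => [->|x2]; last by apply: fixI'; clear -hx x1 x2; lia.
  have := blkI' (k + 2)%N; rewrite fix_y (_ : k + 2 + (r - 1) = r + k + 1)%N.
    by rewrite /partner; move: (ev _ _) => y; clear -hk; lia.
  by clear -r8; lia.
- by rewrite odd_permM (negPf s_even); apply: even_gen hV.
Qed.
End BlockInvariant.

(** * Subgroups containing the alternating group on a set of points *)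

Section AlternatingOn.
Variables (n : nat) (G : {group {perm 'I_n}}).
Implicit Types (A B : pred nat) (s g h : {perm 'I_n}).

Definition alt_on A : Prop :=
  forall s, ~~ odd_perm s -> (forall x, x < n -> ~~ A x -> ev s x = x) -> s \in G.

Lemma alt_onS A B : alt_on A -> (forall x, x < n -> B x -> A x) -> alt_on B.
Proof.
by move=> altA sBA s s_even s_fix; apply: altA => // x xn; move/(contra (sBA x xn)); apply: s_fix.
Qed.

(** If [s] sends [x] to [w] in [A], then [s * g] fixes [x] and is an even permutation supported on
    [A]. *)
Lemma alt_on_step A x :
  (forall w, w < n -> A w -> exists g, [/\ g \in G, ~~ odd_perm g, ev g w = x &
     forall y, y < n -> ~~ A y -> y != x -> ev g y = y]) ->
  x < n -> alt_on A -> alt_on (fun y => A y || (y == x)).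
Proof.
move=> to_x xn altA s s_even s_fix.
have s_fix' y : y < n -> ~~ A y -> y != x -> ev s y = y.
  by move=> yn nA yx; apply: s_fix; rewrite // negb_or nA.
case: (eqVneq (ev s x) x) => [sx|sx].
  by apply: altA => // y yn nA; case: (eqVneq y x) => [->//|]; apply: s_fix'.
have wn := ev_lt s xn.
have Aw : A (ev s x).
  by apply: contraT => nA; have /ev_inj e := s_fix' _ wn nA sx; rewrite e eqxx in sx.
have [g [gG g_even gw g_fix]] := to_x _ wn Aw.
rewrite -(groupMr _ gG); apply: altA => [|y yn nA].
  by rewrite odd_permM (negPf s_even) (negPf g_even).
rewrite evM; case: (eqVneq y x) => [->//|yx].
by rewrite s_fix' // g_fix.
Qed.

(** On two points the property is trivial, the identity being the only even permutation; [t] and its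
    inverse supply what is needed to add the third. *)
Lemma alt_on3 t a b c : t \in G -> ~~ odd_perm t -> uniq [:: a; b; c] -> a < n ->
  ev t a = b -> ev t b = c -> ev t c = a ->
  (forall x, x < n -> x \notin [:: a; b; c] -> ev t x = x) ->
  alt_on (fun x => x \in [:: a; b; c]).
Proof.
move=> tG t_even abc an ta tb tc t_fix.
have alt2 : alt_on (fun x => x \in [:: b; c]).
  move=> s s_even s_fix; rewrite (@even_fix_but_two _ s b c) // => i lin ib ic.
  by apply: s_fix; rewrite // !inE negb_or ib.
apply: alt_onS (alt_on_step _ an alt2) _ => [w wn|x xn]; last first.
  by rewrite !inE orbC.
rewrite !inE => /orP[]/eqP->.
  exists t^-1; split; rewrite ?groupV ?odd_permV // -?ta ?evK // => y yn.
  rewrite !inE ta => nA ya; rewrite -[in LHS](t_fix y yn) ?evK //.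
  by rewrite !inE negb_or ya.
by exists t; split=> // y yn nA ya; apply: t_fix; rewrite // inE negb_or ya.
Qed.

(* The 3-cycle [b -> c -> a -> b], conjugated by [h], moves [h b] to [x]. *)
Lemma alt_on_grow A a b c x h : alt_on A -> h \in G -> uniq [:: a; b; c] ->
  [/\ a < n, b < n & c < n] -> [/\ A a, A b & A c] -> ev h c = x ->
  ~~ A x -> A (ev h a) -> A (ev h b) -> alt_on (fun y => A y || (y == x)).
Proof.
move=> altA hG abc [an bn cn] [Aa Ab Ac] hc nAx Aha Ahb.
have xn : x < n by rewrite -hc ev_lt.
move: abc; rewrite /= !inE negb_or andbT => /andP[/andP[ab ac] bc].
have tp_in p q u : p < n -> q < n -> u < n -> A p -> A q -> A u -> p != q -> p != u ->
    tp n p q * tp n p u \in G /\ ~~ odd_perm (tp n p q * tp n p u).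
  move=> pn qn un Ap Aq Au pq pu.
  have odd_tp' i j : i < n -> j < n -> i != j -> odd_perm (tp n i j).
    move=> lin jn; rewrite neq_ltn => /orP[ij|ji]; first by rewrite odd_tp ?ij.
    rewrite (_ : tp n i j = tp n j i) ?odd_tp ?ji //.
    by apply: eq_ev => y _; rewrite !ev_tp //; clear; ifs.
  have even2 : ~~ odd_perm (tp n p q * tp n p u) by rewrite odd_permM !odd_tp'.
  split=> //; apply: altA => // y yn nAy; rewrite evM !ev_tp //.
  have Ny v : A v -> (y == v) = false by move=> Av; apply: contraNF nAy => /eqP->.
  by rewrite !Ny.
apply: alt_on_step => // w wn Aw.
pose t := tp n b c * tp n b a.
have [tG t_even] : t \in G /\ ~~ odd_perm t by apply: tp_in; rewrite // eq_sym.
have thx : ev (t ^ h) (ev h b) = x.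
  have [cb ca] : (c == b) = false /\ (c == a) = false.
    by rewrite ![c == _]eq_sym (negPf bc) (negPf ac).
  by rewrite /conjg !evM evK (ev_tp b) // eqxx ev_tp // cb ca.
have th_fix y : y < n -> ~~ A y -> y != x -> ev (t ^ h) y = y.
  move=> yn nAy yx; rewrite /conjg !evM.
  have hy : ev h (ev h^-1 y) = y by rewrite -evM mulVg ev1.
  have N v : (A (ev h v)) || (ev h v == x) -> (ev h^-1 y == v) = false.
    move=> Av; apply: contraTF Av => /eqP e; rewrite -e hy negb_or nAy.
    exact: yx.
  by rewrite !ev_tp // !N ?Aha ?Ahb ?hc ?eqxx ?orbT // N ?Aha ?Ahb // N ?Aha.
have [e [eG e_even ew e_fix]] : exists e, [/\ e \in G, ~~ odd_perm e,
    ev e w = ev h b & forall y, y < n -> ~~ A y -> ev e y = y].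
  case: (eqVneq w (ev h b)) => [->|wb].
    by exists 1; split; rewrite ?group1 ?odd_perm1 ?ev1 // => y *; rewrite ev1.
  have [u [un Au uw ub]] : exists u, [/\ u < n, A u, u != w & u != ev h b].
    case: (boolP ((a != w) && (a != ev h b))) => [/andP[]|na]; first by exists a.
    case: (boolP ((b != w) && (b != ev h b))) => [/andP[]|nb]; first by exists b.
    exists c; split=> //; move: na nb ab ac bc wb; clear; move: (ev h b) => v; lia.
  have hbn := ev_lt h bn.
  have [eG e_even] : tp n w (ev h b) * tp n w u \in G /\
      ~~ odd_perm (tp n w (ev h b) * tp n w u) by apply: tp_in; rewrite // eq_sym.
  exists (tp n w (ev h b) * tp n w u); split=> // [|y yn nAy]; rewrite evM !ev_tp // ?eqxx.
    by rewrite (eq_sym _ w) (negPf wb) (eq_sym _ u) (negPf ub).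
  have Ny v : A v -> (y == v) = false by move=> Av; apply: contraNF nAy => /eqP->.
  by rewrite !Ny.
exists (e * t ^ h); split.
- by rewrite groupM ?groupJ.
- by rewrite odd_permM odd_permJ (negPf e_even).
- by rewrite evM ew.
- by move=> y yn nAy yx; rewrite evM e_fix // th_fix.
Qed.

End AlternatingOn.

(** * Alternating groups inside $\langle\rho_k,\dots,\rho_m\rangle$ for $k\le 2<m$ *)

Section SmallLabels.
Variables n r : nat.
Hypotheses (r8 : 8 <= r) (En : n = r.*2.+3).

Local Notation H := (fun i j => gen_by (rho n) (itv r i j)).

Lemma ev_rhoE k i : k < r -> ev (rho n k) i = mv r k i.
Proof. exact: ev_rho. Qed.

(** Squaring $\rho_2\rho_3$ removes the transpositions $(p_3\,p_4)$ and $(z_3\,z_4)$ and leaves a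
    3-cycle on $y_2,y_3,y_4$; as $r\ge 8$, the label 3 is not one of $r-4$, $r-2$. *)
Lemma alt_on_base m k : k <= 2 -> 3 <= m < r ->
  alt_on (H k m.+1) (fun x => 4 <= x <= 6).
Proof.
move=> k2 hm; pose t := rho n 2 * rho n 3 * (rho n 2 * rho n 3).
have mem_rho l : 2 <= l <= 3 -> rho n l \in H k m.+1.
  by move=> hl; apply: mem_gen_itv; clear -hl hm k2; lia.
have tE x : ev t x = mv r 3 (mv r 2 (mv r 3 (mv r 2 x))).
  by rewrite /t !evM !ev_rhoE //; clear -r8; lia.
have mv3 x : mv r 3 x = if x == 5 then 6 else if x == 6 then 5 else
    if x == (r + 4)%N then (r + 5)%N else if x == (r + 5)%N then (r + 4)%N else x.
  by clear -r8; rewrite /mv; ifs.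
have mv2 x : mv r 2 x = if x == 2 then 3 else if x == 3 then 2 else
    if x == 4 then 5 else if x == 5 then 4 else x by [].
have tG : t \in H k m.+1 by rewrite !groupM // mem_rho.
have t_even : ~~ odd_perm t by rewrite /t !odd_permM !(even_rho _ r8 En).
have n4 : 4 < n by rewrite En; clear -r8; lia.
have t4 : ev t 4 = 5 by rewrite tE !mv2 !mv3 /=; clear -r8; ifs.
have t5 : ev t 5 = 6 by rewrite tE !mv2 !mv3 /=; clear -r8; ifs.
have t6 : ev t 6 = 4 by rewrite tE !mv2 !mv3 /=; clear -r8; ifs.
have t_fix x : x < n -> x \notin [:: 4; 5; 6] -> ev t x = x.
  move=> _; rewrite !inE => hx; rewrite tE.
  case: (boolP [|| x == 2, x == 3, x == r + 4 | x == r + 5]%N).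
    by case/or4P => /eqP->; rewrite !mv2 !mv3 /=; clear -r8; ifs.
  move=> hx2; have e2 : mv r 2 x = x by rewrite mv2; clear -hx hx2; ifs.
  have e3 : mv r 3 x = x by rewrite mv3; clear -hx hx2; ifs.
  by rewrite !(e2, e3).
apply: alt_onS (alt_on3 tG t_even _ n4 t4 t5 t6 t_fix) _ => // x _ /=.
by rewrite !inE; clear; lia.
Qed.

Lemma alt_on_rho m k A a b c x l : 3 <= m < r -> alt_on (H k m.+1) A ->
  k <= l <= m -> [&& A a, A b & A c] -> uniq [:: a; b; c] ->
  [&& a < n, b < n & c < n] -> mv r l c = x -> ~~ A x ->
  A (mv r l a) -> A (mv r l b) -> alt_on (H k m.+1) (fun y => A y || (y == x)).
Proof.
move=> hm altA hl /and3P[Aa Ab Ac] abc /and3P[an bn cn] hc nAx Aha Ahb.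
have lr : l < r by clear -hl hm; lia.
by apply: (@alt_on_grow _ _ A a b c x (rho n l)); rewrite ?ev_rhoE // mem_gen_itv // ltnS.
Qed.

(** The last $y$ is $y_{m+1}$, except that for $m=r-1$ also $y_{r+1}$ is joined, through $y_r$ and
    the label $r-2$. *)
Definition last_y m := (m + 3 + (m.+1 == r))%N.

(** The labels used here are at least 4 and fix $y_2,y_3$, which therefore serve as the other two
    points of each 3-cycle. *)
Lemma alt_on_y m k : k <= 2 -> 3 <= m < r ->
  alt_on (H k m.+1) (fun x => 4 <= x <= last_y m).
Proof.
move=> k2 hm.
have up d : d + 6 <= m + 3 -> alt_on (H k m.+1) (fun x => 4 <= x <= d + 6).
  elim: d => [|d IHd] hd; first exact: alt_on_base.
  have {}IHd := IHd (ltnW hd).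
  apply: alt_onS (@alt_on_rho _ _ _ 4 5 (d + 6) (d + 7) (d + 4) hm IHd _ _ _ _ _ _ _ _) _.
  - by clear -hd k2; lia.
  - by clear; lia.
  - by rewrite /= !inE; clear; lia.
  - by rewrite En; clear -hd hm; lia.
  - by clear -r8; rewrite /mv; ifs.
  - by clear; lia.
  - by clear -r8 hd hm; rewrite /mv; ifs.
  - by clear -r8 hd hm; rewrite /mv; ifs.
  - by move=> x _; clear; lia.
have {}up : alt_on (H k m.+1) (fun x => 4 <= x <= m + 3).
  by have := up (m - 3)%N; rewrite (_ : m - 3 + 6 = m + 3)%N; [apply | clear -hm; lia].
rewrite /last_y; case: eqP => em; last by rewrite addn0.
apply: alt_onS (@alt_on_rho _ _ _ 4 5 (r + 2) (r + 3) (r - 2) hm up _ _ _ _ _ _ _ _) _.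
- by clear -em k2 r8; lia.
- by clear -em r8; lia.
- by rewrite /= !inE; clear -r8; lia.
- by rewrite En; clear -r8; lia.
- by clear -r8; rewrite /mv; ifs.
- by clear -em; lia.
- by clear -r8 em; rewrite /mv; ifs.
- by clear -r8 em; rewrite /mv; ifs.
- by move=> x _; clear -em; lia.
Qed.

Lemma alt_on_yz m k : k <= 2 -> m < r <= m + 3 ->
  alt_on (H k m.+1) (fun x => (4 <= x <= last_y m) || (r + 4 <= x <= last_y m + (r - 1))).
Proof.
move=> k2 mr3; have hm : 3 <= m < r by clear -mr3 r8; lia.
have hl : m + 3 <= last_y m <= r + 3 by rewrite /last_y; clear -mr3; lia.
have altY := alt_on_y k2 hm; move: (last_y m) hl altY => h hl altY.
have up d : r + d <= h -> alt_on (H k m.+1)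
    (fun x => (4 <= x <= h) || (r + (r - 1) <= x <= r + d + (r - 1))).
  elim: d => [|d IHd] hd.
    apply: alt_onS (@alt_on_rho _ _ _ 4 5 r (r + (r - 1)) (r - 4) hm altY _ _ _ _ _ _ _ _) _.
    - by clear -mr3 k2 r8; lia.
    - by clear -hl mr3 r8; lia.
    - by rewrite /= !inE; clear -r8; lia.
    - by rewrite En; clear -r8; lia.
    - by clear -r8; rewrite /mv; ifs.
    - by clear -hl r8; lia.
    - by clear -r8 hl mr3; rewrite /mv; ifs.
    - by clear -r8 hl mr3; rewrite /mv; ifs.
    - by move=> x _; clear; lia.
  have {}IHd : _ := IHd (_ : r + d <= h); have hd' : r + d <= h by clear -hd; lia.
  apply: alt_onS (@alt_on_rho _ _ _ 4 5 (r + d.+1) (r + d.+1 + (r - 1)) (r - 4) hm (IHd hd')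
    _ _ _ _ _ _ _ _) _.
  - by clear -mr3 k2 r8; lia.
  - by clear -hl hd mr3 r8; lia.
  - by rewrite /= !inE; clear -r8; lia.
  - by rewrite En; clear -r8 hd hl; lia.
  - by clear -r8 hd hl; rewrite /mv; ifs.
  - by clear -hl hd r8; lia.
  - by clear -r8 hl mr3; rewrite /mv; ifs.
  - by clear -r8 hl mr3; rewrite /mv; ifs.
  - by move=> x _; clear -hd; lia.
have down d : r + 4 <= (r.*2.-1 - d)%N -> alt_on (H k m.+1)
    (fun x => (4 <= x <= h) || (r.*2.-1 - d <= x <= h + (r - 1))).
  elim: d => [|d IHd] hd.
    apply: alt_onS (up (h - r)%N _) _; first by clear -hl mr3; lia.
    by move=> x _; clear -hl mr3; lia.
  have hd' : r + 4 <= r.*2.-1 - d by clear -hd; lia.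
  apply: alt_onS (@alt_on_rho _ _ _ 4 5 (r.*2.-1 - d) (r.*2.-1 - d.+1)
    (r.*2.-1 - d.+1 - r - 1) hm (IHd hd') _ _ _ _ _ _ _ _) _.
  - by clear -hd mr3 k2 r8; lia.
  - by clear -hl hd mr3 r8; lia.
  - by rewrite /= !inE; clear -r8 hd; lia.
  - by rewrite En; clear -r8 hd hl; lia.
  - by clear -r8 hd hl; rewrite /mv; ifs.
  - by clear -hl hd r8; lia.
  - by clear -r8 hl mr3 hd; rewrite /mv; ifs.
  - by clear -r8 hl mr3 hd; rewrite /mv; ifs.
  - by move=> x _; clear -hd; lia.
apply: alt_onS (down (r - 5)%N _) _; first by clear -r8; lia.
by move=> x _; clear -r8; lia.
Qed.

(* The points other than $p_1,\dots,p_4$ that $\langle\rho_2,\dots,\rho_m\rangle$ permutes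
   as the full alternating group. *)
Definition upper m x :=
  (4 <= x <= last_y m) || ((r <= m + 3) && (r + 4 <= x <= last_y m + (r - 1))).

(** For $k=2$ the value is 4, not 2: $p_3$ and $p_4$ form an orbit of size two and cannot join the
    alternating part. *)
Definition low (k : nat) : nat := nth 0%N [:: 0%N; 1%N; 4] k.

(** $p_4,p_3,p_2,p_1$ are attached in turn by the labels 1, 2, 1, 0, with $y_3,y_4$ as the other
    points of the 3-cycle. *)
Lemma alt_on_low m k : k <= 2 -> 3 <= m < r ->
  alt_on (H k m.+1) (fun x => (low k <= x < 4) || upper m x).
Proof.
move=> k2 hm; have hl : m + 3 <= last_y m <= r + 3 by rewrite /last_y; clear -hm; lia.
have alt2 : alt_on (H k m.+1) (upper m).
  rewrite /upper; case: (leqP r (m + 3)) => mr3.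
    by apply: alt_onS (@alt_on_yz m k _ _) _ => //; clear -hm mr3; lia.
  by apply: alt_onS (@alt_on_y m k _ _) _ => // x _; rewrite orbF.
have n10 : 10 < n by rewrite En; clear -r8; lia.
have up y : 4 <= y <= 6 -> upper m y by rewrite /upper; clear -hl hm; lia.
have nup y : y < 4 -> upper m y = false by rewrite /upper; clear; lia.
have [u4 u5 u6] : [/\ upper m 4, upper m 5 & upper m 6] by rewrite !up.
have step j l : alt_on (H k m.+1) (fun x => (j < x < 4) || upper m x) -> j < 4 ->
    k <= l <= 2 -> mv r l j.+1 = j -> upper m (mv r l 5) -> upper m (mv r l 6) ->
    alt_on (H k m.+1) (fun x => (j <= x < 4) || upper m x).
  move=> altj j4 hkl mvj u5' u6'.
  apply: alt_onS (@alt_on_rho _ _ _ 5 6 j.+1 j l hm altj _ _ _ _ mvj _ _ _) _.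
  - by clear -hkl hm; lia.
  - rewrite u5 u6 !orbT ltnSn /=; case: (ltnP j.+1 4) => // j3.
    by rewrite (_ : j.+1 = 4) ?u4 //; clear -j4 j3; lia.
  - by rewrite /= !inE; clear -j4; lia.
  - by clear -n10 j4; lia.
  - by rewrite nup // ltnn.
  - by rewrite u5' orbT.
  - by rewrite u6' orbT.
  - move=> x _ /orP[hx|->]; last by rewrite orbT.
    by case: (eqVneq x j) => [_|xj]; rewrite ?orbT // orbF; apply/orP; left;
      clear -hx xj; lia.
have alt4 : alt_on (H k m.+1) (fun x => (3 < x < 4) || upper m x).
  by apply: alt_onS alt2 _ => x _; case: (upper m x); rewrite ?orbT // orbF; clear; lia.
case: (leqP 2 k) => k1.
  by have -> : low k = 4 by have -> : k = 2 by clear -k1 k2; lia.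
have alt3 : alt_on (H k m.+1) (fun x => (2 < x < 4) || upper m x).
  by apply: (step 3 1%N) => //; rewrite -ltnS k1.
have alt2' : alt_on (H k m.+1) (fun x => (1 < x < 4) || upper m x).
  by apply: (step 2 2) => //; rewrite k2.
have alt1 : alt_on (H k m.+1) (fun x => (0 < x < 4) || upper m x).
  by apply: (step 1%N 1%N) => //; rewrite -ltnS k1.
case: (posnP k) => k0; last first.
  by have -> : low k = 1%N by have -> : k = 1%N by clear -k0 k1; lia.
have -> : low k = 0%N by rewrite k0.
by apply: (step 0%N 0%N) => //; rewrite k0.
Qed.
End SmallLabels.

(** * The intersection for $k\le 2<m$ *)

Section SmallCase.
Variables n r m k : nat.
Hypotheses (r8 : 8 <= r) (En : n = r.*2.+3) (hm : 3 <= m < r) (k2 : k <= 2).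

Local Notation H := (fun i j => gen_by (rho n) (itv r i j)).

Let fixes_low (s : {perm 'I_n}) := forall x, x < low k -> ev s x = x.

Let low4 : low k <= 4.
Proof. by move: k2; rewrite /low; case: (k) => [|[|[|]]]. Qed.

Let fixes_low_rho s l : 3 <= l < r -> fixes_low s -> fixes_low (s * rho n l).
Proof.
move=> hl s_low x hx; have x4 := leq_trans hx low4.
rewrite evM s_low // (ev_rho _ r8 En); last by case/andP: hl.
by clear -x4 hl; rewrite /mv; ifs.
Qed.

Let small_fixed s : ~~ odd_perm s -> fixes_low s ->
  (forall x, x < n -> (last_y r m < x <= r + 3) || (last_y r m + (r - 1) < x) -> ev s x = x) ->
  (m + 4 <= r -> forall x, r + 4 <= x <= r + m + 2 -> ev s x = x) ->
  s \in H k m.+1.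
Proof.
move=> s_even s_low s_top s_z; apply: (alt_on_low r8 En k2 hm s_even) => x xn.
rewrite /upper negb_or => /andP[nlow nup].
case: (ltnP x (low k)) => xl; first exact: s_low.
case: (leqP (m + 4) r) => m4; last first.
  by apply: s_top => //; move: nlow nup xl; clear -m4 low4 hm r8; lia.
case: (boolP (r + 4 <= x <= r + m + 2)) => hx; first exact: s_z.
by apply: s_top => //; move: nlow nup xl hx; rewrite /last_y; clear -m4 low4 hm r8; lia.
Qed.

(** The action on the top points is cancelled by [g], the product of generators spelled by the
    involutory word [t]. Its labels are at least $r-5\ge 3$, so the low points stay fixed, and for
    $m\le r-4$ it moves none of the $z_j$ with $j\le m+1$. *)
Let small_z_fixed s : ~~ odd_perm s -> fixes_low s -> top_inv r m s ->
  (m + 4 <= r -> forall x, r + 4 <= x <= r + m + 2 -> ev s x = x) ->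
  s \in H k m.+1.
Proof.
move=> s_even s_low [sc st sf] s_z.
case: (leqP r (m + 5)) => m5; last first.
  apply: small_fixed => // x xn hx; apply: sf => //.
  by move: hx; rewrite /last_y; clear -m5; lia.
have [t tV ht] := st m5; have j5 : 0 < r - m <= 5 by clear -hm m5; lia.
have t_let := top_words_letters j5 tV.
pose g := \prod_(l <- t) rho n (r - l).
have t5 : all (fun l => 0 < l <= 5) t by apply: sub_all t_let => l; clear -j5; lia.
have gH (i : nat) : i <= 3 -> g \in H i m.+1.
  move=> i3; rewrite /g big_seq; apply: group_prod => l /(allP t_let) hl.
  by apply: mem_gen_itv; clear -hl r8 hm i3; lia.
rewrite -(groupMr _ (gH k _)); last by clear -k2; lia.
have g_even : ~~ odd_perm g by apply: even_gen (gH 0 _).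
apply: small_fixed.
- by rewrite odd_permM (negPf s_even).
- apply: (gen_by_ind (P := fixes_low) _ (gH 3 _) s_low) => // u l; rewrite inE => /andP[l3 _].
  by apply: fixes_low_rho; rewrite l3 ltn_ord.
- move=> x xn hx; pose q := (if x <= r + 3 then x - (r - 3) else x - (r.*2 - 4) + 7)%N.
  have [q14 topq ->] : [/\ q < 14, in_top (r - m) q & x = pt r q].
    move: hx xn; rewrite En /q /in_top /pt /last_y; clear -r8 hm m5 => hx xn.
    by case: eqP hx => em hx; split; ifs.
  have j6 : 0 < r - m <= 6 by clear -j5; lia.
  by rewrite evM ht // ev_word ?word_mv_lt // (top_words_invol j5 tV).
move=> m4 x hx; rewrite evM s_z //.
case: (leqP r (m + 4)) => m4'; last first.
  move: tV; rewrite (_ : r - m = 5)%N; last by clear -m4' m5; lia.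
  by rewrite inE => /eqP e; rewrite /g e big_nil ev1.
have {m4'} jE : (r - m = 4)%N by clear -m4 m4'; lia.
rewrite jE in tV.
case: (boolP (has (fun q => x == pt r q) (iota 0 14))) => [/hasP[q]|/hasPn np].
  rewrite mem_iota => q14 /eqP def_x; rewrite def_x ev_word // (top_words4 tV) //.
  move: hx; rewrite def_x /in_top /pt; clear -r8 jE q14.
  by move=> hx; apply/negP => /andP[_ h]; move: hx h; ifs.
have w_np (w : seq nat) : all (fun l => 0 < l <= 5) w ->
    ev (\prod_(l <- w) rho n (r - l)) x = x.
  elim: w => [|l w IHw]; first by rewrite big_nil ev1.
  case/andP=> l5 w5; rewrite big_cons evM (ev_rho _ r8 En); last by clear -r8 l5; lia.
  rewrite mv_not_pt ?IHw // => q hq; by apply: np; rewrite mem_iota.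
exact: w_np.
Qed.

Let walk_z c d : m + 4 <= r -> r + 4 <= c - d -> c <= r + m + 2 ->
  exists2 h, h \in H 3 m.+1 & ev h (c - d)%N = c /\
    forall x, c < x <= r + m + 2 -> ev h x = x.
Proof.
move=> m4; elim: d => [|d IHd] hd hc.
  by exists 1; rewrite ?group1 // subn0 ev1; split=> // x _; rewrite ev1.
have [||h hH [hcd h_fix]] := IHd; [by clear -hd; lia | by [] | ].
have lr : c - d.+1 - r - 1 < r by clear -hc m4; lia.
exists (rho n (c - d.+1 - r - 1) * h).
  by rewrite groupM // mem_gen_itv //; clear -hd hc m4; lia.
rewrite evM (ev_rho _ r8 En lr); split=> [|x hx].
  rewrite (_ : mv _ _ _ = c - d)%N //.
  by clear -r8 hd hc m4; rewrite /mv; ifs.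
rewrite evM (ev_rho _ r8 En lr) (_ : mv _ _ _ = x) ?h_fix //.
by clear -r8 hd hc m4 hx; rewrite /mv; ifs.
Qed.

(** For $m\le r-4$ the alternating group found above contains no $z$ in its support. The $z$'s are
    therefore sorted from $z_{m+1}$ downwards with elements of $\langle\rho_3,\dots,\rho_m\rangle$,
    whatever these do to the $y$'s; the even remainder on the $p$'s and $y$'s is then covered. *)
Let small_low_fixed s : ~~ odd_perm s -> fixes_low s -> top_inv r m s -> s \in H k m.+1.
Proof.
move=> s_even s_low topI.
case: (leqP (m + 4) r) => m4; last by apply: small_z_fixed => //; clear -m4; lia.
have key c : r + 3 <= c -> forall s, ~~ odd_perm s -> fixes_low s -> top_inv r m s ->
    (forall x, c < x <= r + m + 2 -> ev s x = x) -> s \in H k m.+1.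
  elim: c => [|c IHc] hc u u_even u_low topU u_fix; first by exfalso; clear -hc; lia.
  case: (leqP (r + 4) c.+1) => hc4; last first.
    by apply: small_z_fixed => // _ x hx; apply: u_fix; clear -hc4 hx; lia.
  case: (leqP c.+1 (r + m + 2)) => hcm; last first.
    apply: IHc => //; first by clear -hcm hm; lia.
    by move=> x hx; exfalso; clear -hx hcm; lia.
  have [uc _] := topU; have := (uc m4 c.+1).2; rewrite hc4 hcm => /(_ isT) hu.
  have hu2 : ev u c.+1 <= c.+1.
    rewrite leqNgt; apply/negP=> hu2; have := u_fix (ev u c.+1).
    rewrite hu2 (andP hu).2 => /(_ isT)/ev_inj e; move: hu2; rewrite e; clear; lia.
  have [||h hH [def_h h_fix]] := @walk_z c.+1 (c.+1 - ev u c.+1) m4.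
  - by rewrite subKn //; case/andP: hu.
  - by [].
  rewrite subKn // in def_h.
  have hHk : h \in H k m.+1.
    apply: subsetP hH; apply/gen_byS/subsetP=> x; rewrite !inE; clear -k2; lia.
  suff: u * h \in H k m.+1 by rewrite groupMr.
  apply: IHc; first by clear -hc4; lia.
  - by rewrite odd_permM (negPf u_even); apply: even_gen hHk.
  - apply: (gen_by_ind (P := fixes_low) _ hH u_low) => t l; rewrite inE => /andP[l3 _].
    by apply: fixes_low_rho; rewrite l3 ltn_ord.
  - apply: (gen_by_ind (P := top_inv r m) _ hH topU) => t l; rewrite inE => /andP[_ lm].
    by apply: (top_inv_rho r8 En); rewrite // -ltnS.
  move=> x hx; rewrite evM; case: (eqVneq x c.+1) => [->//|xc].
  have hx' : c.+1 < x <= r + m + 2 by clear -hx xc; lia.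
  by rewrite u_fix ?h_fix.
apply: (key (r + m + 2)%N) => //; first by clear -hm; lia.
by move=> x hx; exfalso; clear -hx; lia.
Qed.

Definition low_inv (s : {perm 'I_n}) : Prop :=
  (0 < k -> ev s 0 = 0%N) /\
  (1 < k -> [/\ ev s 1 = 1%N, 2 <= ev s 2 <= 3 & 2 <= ev s 3 <= 3]).

Lemma small_case s : ~~ odd_perm s -> low_inv s -> top_inv r m s -> s \in H k m.+1.
Proof.
move=> s_even [s0 s1] topI.
case: (leqP k 1) => k1.
  apply: small_low_fixed => // x; rewrite /low.
  by move: s0 k1; case: (k) => [|[|]] //= s0 _; case: x => // _; apply: s0.
have kE : k = 2 by clear -k1 k2; lia.
have [{}s1 s2 s3] := s1 k1; have {}s0 := s0 (ltnW k1).
have s23 : ev s 2 != ev s 3 by apply/eqP => /ev_inj.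
have low2 : low k = 4 by rewrite kE.
case: (eqVneq (ev s 2) 2) => e2.
  apply: small_low_fixed => // x; rewrite low2.
  case: x => [|[|[|[|]]]] // _.
  by move: s23 s3; rewrite e2; move: (ev s 3) => y; clear; lia.
(* The remaining possibility is that $p_3$ and $p_4$ are exchanged, which $\rho_2$ undoes. *)
have r2 : rho n 2 \in H k m.+1 by rewrite mem_gen_itv ?kE //; clear -hm r8; lia.
have {}e2 : ev s 2 = 3 by move: s2 e2; move: (ev s 2) => y; clear; lia.
have e3 : ev s 3 = 2 by move: s23 s3; rewrite e2; move: (ev s 3) => y; clear; lia.
have rE x : ev (s * rho n 2) x = mv r 2 (ev s x).
  by rewrite evM (ev_rho _ r8 En) //; clear -r8; lia.
rewrite -(groupMr _ r2); apply: small_low_fixed.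
- by rewrite odd_permM (even_rho _ r8 En) addbF.
- move=> x; rewrite low2 rE.
  by case: x => [|[|[|[|]]]] // _; rewrite ?s0 ?s1 ?e2 ?e3.
- by apply: (top_inv_rho r8 En) topI => //; clear -hm; lia.
Qed.

End SmallCase.

(** * Coset enumeration for the labels 0, 1, 2 *)

(** [mv 0] stands for every [mv r] here, since only labels below 3 are fed to it. *)
Definition low_act (w : seq nat) (x : nat) : nat := foldl (fun y l => mv 0 l y) x w.

(* Words representing the right cosets of $\langle\rho_{a+1},\dots,\rho_{m-1}\rangle$ in
   $\langle\rho_a,\dots,\rho_{m-1}\rangle$, and words for all elements of the former. *)
Definition coset_words (a m : nat) : seq (seq nat) :=
  (match a, m with
  | 0, 3 => [:: [::]; [:: 0]; [:: 0; 1]; [:: 0; 1; 0]; [:: 0; 1; 0; 1]; [:: 0; 1; 0; 1; 2]]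
  | 1, 3 => [:: [::]; [:: 1]; [:: 1; 2]; [:: 1; 2; 1]; [:: 1; 2; 1; 2]]
  | 0, 2 => [:: [::]; [:: 0]; [:: 0; 1]; [:: 0; 1; 0]; [:: 0; 1; 0; 1]]
  | _, _ => [:: [::]; [:: a]]
  end)%N.
Definition subgroup_words (a m : nat) : seq (seq nat) :=
  (match a, m with
  | 0, 3 => [:: [::]; [:: 1]; [:: 2]; [:: 1; 2]; [:: 2; 1]; [:: 1; 2; 1]; [:: 2; 1; 2];
                [:: 1; 2; 1; 2]; [:: 2; 1; 2; 1]; [:: 1; 2; 1; 2; 1]]
  | 1, 3 => [:: [::]; [:: 2]]
  | 0, 2 => [:: [::]; [:: 1]]
  | _, _ => [:: [::]]
  end)%N.

Definition same_low_act (w w' : seq nat) : bool :=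
  all (fun x => low_act w x == low_act w' x) (iota 0 6).

Lemma coset_table a m : a < m <= 3 ->
  [/\ forall t l, t \in coset_words a m -> a <= l < m ->
        exists t' h, [/\ t' \in coset_words a m, h \in subgroup_words a m &
                         same_low_act (rcons t l) (h ++ t')],
      forall t, t \in coset_words a m -> low_act t a = a -> t = [::],
      forall t, t \in coset_words a m -> all (fun l => l < 3) t
    & forall h, h \in subgroup_words a m -> all (fun l => a < l < m) h].
Proof.
have /allP Hl : all (fun m => all (fun a => [&& 
    all (fun t => all (fun l => has (fun t' => has (fun h =>
      same_low_act (rcons t l) (h ++ t')) (subgroup_words a m)) (coset_words a m))
      (iota a (m - a))) (coset_words a m),
    all (fun t => (low_act t a == a) ==> (t == [::])) (coset_words a m),
    all (all (fun l => l < 3)) (coset_words a m) &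
    all (all (fun l => a < l < m)) (subgroup_words a m)]) (iota 0 m)) (iota 1 3)
  by vm_compute.
case/andP=> am m3; have /Hl/allP/(_ a) : m \in iota 1 3 by rewrite mem_iota; clear -am m3; lia.
rewrite mem_iota => /(_ am)/and4P[/allP h1 /allP h2 /allP h3 /allP h4].
split=> // [t l tT hl|t tT /eqP ta].
  have /allP h1t := h1 t tT; have : l \in iota a (m - a) by rewrite mem_iota subnKC // ltnW.
  by move=> /h1t/hasP[t' t'T /hasP[h hh e]]; exists t', h.
by apply/eqP; have := h2 t tT; rewrite ta.
Qed.

(** * The intersection property for intervals *)

Section Intersection.
Variables n r : nat.
Hypotheses (r8 : 8 <= r) (En : n = r.*2.+3).

Local Notation H := (fun i j => gen_by (rho n) (itv r i j)).

Lemma ev_low_word w x : all (fun l => l < 3) w ->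
  ev (\prod_(l <- w) rho n l) x = low_act w x.
Proof.
elim: w x => [|l w IHw] x; first by rewrite big_nil ev1.
case/andP=> l3 w3; rewrite big_cons evM (ev_rho _ r8 En); last first.
  by clear -l3 r8; lia.
by rewrite IHw // /low_act /=; congr foldl; move: l3; case: (l) => [|[|[|]]].
Qed.

Lemma low_act_big w x : all (fun l => l < 3) w -> 6 <= x -> low_act w x = x.
Proof.
elim: w => //= l w IHw /andP[l3 w3] hx; rewrite /low_act /= (_ : mv 0 l x = x) ?IHw //.
  exact: IHw.
by move: l3; case: (l) => [|[|[|]]] // _; rewrite /mv /=; clear -hx; ifs.
Qed.

Lemma same_low_actP w w' : all (fun l => l < 3) w -> all (fun l => l < 3) w' ->
  same_low_act w w' -> \prod_(l <- w) rho n l = \prod_(l <- w') rho n l.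
Proof.
move=> w3 w3' /allP e; apply: eq_ev => x _; rewrite !ev_low_word //.
case: (ltnP x 6) => hx; last by rewrite !low_act_big.
by apply/eqP/e; rewrite mem_iota.
Qed.

(** By the table the products $h\cdot t$ are closed under right multiplication by the generators. As
    $h$ fixes the point $a$, so does $t$, and the empty word is the only representative that does.
    For $\langle\rho_0,\rho_1,\rho_2\rangle$ these are the six cosets of a dihedral group of order
    10. *)
Lemma stabiliser_step a m s : a < m <= 3 -> s \in H a m -> ev s a = a -> s \in H a.+1 m.
Proof.
move=> am sH sa; have [tab nil_only t3 hl] := coset_table am.
have h3 h : h \in subgroup_words a m -> all (fun l => l < 3) h.
  by move/hl; apply: sub_all => l; clear -am; lia.
have hH h : h \in subgroup_words a m -> \prod_(l <- h) rho n l \in H a.+1 m.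
  move/hl/allP=> hl'; rewrite big_seq; apply: group_prod => l /hl' hlm.
  by apply: mem_gen_itv => //; clear -hlm am r8; lia.
have a_fix h : h \in H a.+1 m -> ev h a = a.
  move=> hh; have := gen_by_ind (P := fun t => ev t a = a) _ hh (ev1 _ a).
  rewrite mul1g; apply=> t k; rewrite inE evM => /andP[ak km] ->.
  rewrite (ev_rho _ r8 En) ?ltn_ord //; move: ak km am; move: (val k) => l; clear.
  by case: a => [|[|[|a]]]; case: l => [|[|[|l]]] //; clear; lia.
suff [t [tT [h hh def_s]]] : exists t, t \in coset_words a m /\
    exists2 h, h \in H a.+1 m & s = h * \prod_(l <- t) rho n l.
  have t_nil : t = [::].
    apply: nil_only => //; rewrite -ev_low_word ?t3 // -[X in ev _ X](a_fix h hh) -evM.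
    by rewrite -def_s.
  by rewrite def_s t_nil big_nil mulg1.
pose P s := exists t, t \in coset_words a m /\
    exists2 h, h \in H a.+1 m & s = h * \prod_(l <- t) rho n l.
have P1 : P 1.
  exists [::]; split; last by exists 1; rewrite ?group1 // big_nil mulg1.
  by rewrite /coset_words; move: am; case: (a) => [|[|[|?]]]; case: (m) => [|[|[|[|?]]]].
have := gen_by_ind (P := P) _ sH P1; rewrite mul1g; apply=> u k kJ [t [tT [h hh ->]]].
have akm : a <= k < m by rewrite inE in kJ.
have [t' [h' [t'T h'T e]]] := tab t k tT akm.
exists t'; split=> //; exists (h * \prod_(l <- h') rho n l); first by rewrite groupM ?hH.
have k3 : k < 3 by clear -akm am; lia.
rewrite -!mulgA; congr (_ * _).
have : \prod_(l <- rcons t k) rho n l = \prod_(l <- h' ++ t') rho n l.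
  by apply: same_low_actP e; [rewrite all_rcons k3 t3 | rewrite all_cat h3 ?t3].
by rewrite -cats1 !big_cat big_seq1.
Qed.

Lemma low_fixed k s x : s \in H k r -> x < k -> x <= 2 -> ev s x = x.
Proof.
move=> sH xk x2; have := gen_by_ind (P := fun t => ev t x = x) _ sH (ev1 _ x).
rewrite mul1g; apply=> t l; rewrite inE evM => /andP[kl _] ->.
rewrite (ev_rho _ r8 En) ?ltn_ord //; move: (leq_trans xk kl) x2; move: (val l) => j; clear.
by case: j => [|[|[|j]]]; case: x => [|[|[|x]]] // _ _; rewrite /mv /=; ifs.
Qed.

Lemma low_inv_gen k s : s \in H k r -> low_inv k s.
Proof.
move=> sH; split=> [k0|k1]; first exact: low_fixed sH _ _.
have P x : 2 <= x <= 3 -> 2 <= ev s x <= 3.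
  move=> hx; have b1 : 2 <= ev (1 : {perm 'I_n}) x <= 3 by rewrite ev1.
  have := gen_by_ind (P := fun t => 2 <= ev t x <= 3) _ sH b1.
  rewrite mul1g; apply=> t l; rewrite inE evM => /andP[kl _].
  rewrite (ev_rho _ r8 En) ?ltn_ord //; move: (ev t x) (leq_trans k1 kl) => y.
  by move: (val l) => j; clear => hj hy; rewrite /mv; ifs.
by split; [exact: low_fixed sH _ _ | exact: P | exact: P].
Qed.

Lemma itv_intersection m k : m <= r -> k < r -> H 0 m :&: H k r \subset H k m.
Proof.
move=> mr kr; apply/subsetP=> s /setIP[sm sk].
case: (ltnP 3 m) => m3.
  (* From here on [m] is the last label of the first group instead of its exclusive bound. *)
  case: m mr m3 sm => // m mr m3 sm.
  have s_even := even_gen r8 En sm.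
  have topI : top_inv r m s.
    have := gen_by_ind (P := top_inv r m) _ sm (top_inv1 r8 En mr).
    rewrite mul1g; apply=> t l; rewrite inE => /andP[_ lm].
    by apply: (top_inv_rho r8 En); rewrite ?mr ?andbT // -ltnS.
  have hm : 3 <= m < r by rewrite mr andbT -ltnS.
  case: (leqP k 2) => k2; first by apply: small_case => //; apply: low_inv_gen.
  case: (leqP k (r - 5)) => k5.
    apply: (middle_case r8 En hm) => //; first by rewrite k2.
    have b1 : block_inv r k (1 : {perm 'I_n}) by apply: block_inv1.
    have := gen_by_ind (P := block_inv r k) _ sk b1.
    rewrite mul1g; apply=> t l; rewrite inE => /andP[kl lr].
    by apply: block_inv_rho; rewrite // k2.
  apply: (base_case r8 En hm) => //; first by clear -kr k5; lia.
  have b1 : bottom_inv r (r - k) (1 : {perm 'I_n}) by apply: bottom_inv1.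
  have := gen_by_ind (P := bottom_inv r (r - k)) _ sk b1.
  rewrite mul1g; apply=> t l; rewrite inE => /andP[kl lr].
  by apply: bottom_inv_rho => //; clear -k5 kl kr; lia.
(* An element of the second group fixes the points 0, 1, 2 as far as they lie below [k], so the
   generators of the first group can be peeled off from 0 upwards. *)
have key a : a <= k -> a <= m -> s \in H a m.
  elim: a => // a IHa ak am; apply: stabiliser_step; rewrite ?am ?IHa ?(ltnW ak) ?(ltnW am) //.
  by apply: low_fixed sk _ _ => //; clear -am m3; lia.
case: (leqP k m) => km; first exact: key.
apply: subsetP (key m (ltnW km) (leqnn m)); apply/gen_byS/subsetP=> x.
by rewrite !inE; clear; lia.
Qed.

End Intersection.

(** * Orders, commutation and the Schläfli type *)

Section Orders.
Variables n r : nat.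
Hypotheses (r8 : 8 <= r) (En : n = r.*2.+3).

Lemma rho_invol k : k < r -> rho n k * rho n k = 1.
Proof.
move=> kr; apply: eq_ev => x _; rewrite ev1 evM !(ev_rho _ r8 En kr).
by clear -kr r8; rewrite /mv; ifs.
Qed.

Lemma rho_neq1 k : k < r -> rho n k != 1.
Proof.
(* The moved points chosen are 0, 2, 3 for the labels 0, 1, 2, and $y_k=k+2$ afterwards. *)
move=> kr; apply/eqP => e; have := ev1 n (if k == 0 then 0 else k + (2 < k).+1)%N.
rewrite -e (ev_rho _ r8 En kr); clear -kr; rewrite /mv.
by case: k kr => [|[|[|k]]] //= _; ifs.
Qed.

Lemma order_rho k : k < r -> #[rho n k] = 2.
Proof.
by move=> kr; apply: nt_prime_order; rewrite ?rho_neq1 // expgS expg1 rho_invol.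
Qed.

Lemma word_eq1 w : all (fun l => 0 < l <= 5) w ->
  all (fun q => word_mv w q == q) (iota 0 14) -> \prod_(l <- w) rho n (r - l) = 1.
Proof.
move=> w5 /allP wE; apply: eq_ev => x _; rewrite ev1.
case: (boolP (has (fun q => x == pt r q) (iota 0 14))) => [/hasP[q]|/hasPn np].
  by move=> q14 /eqP->; rewrite mem_iota in q14 *; rewrite (ev_word r8 En) //;
     rewrite (eqP (wE q _)) // mem_iota.
elim: w w5 {wE} => [|i w IHw]; first by rewrite big_nil ev1.
case/andP=> i5 w5; rewrite big_cons evM (ev_rho _ r8 En); last by clear -r8 i5; lia.
by rewrite mv_not_pt ?IHw // => q hq; apply: np; rewrite mem_iota.
Qed.

Lemma comm_of_invol (s t : {perm 'I_n}) :
  s * s = 1 -> t * t = 1 -> s * t * s * t = 1 -> commute s t.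
Proof.
move=> ss tt st; rewrite /commute -[RHS]mul1g -st -!mulgA (mulgA t t) tt mul1g ss mulg1.
by [].
Qed.

(** For $i\le r-6$ this set contains all points moved by $\rho_i$ and is fixed pointwise by $\rho_j$
    for $3\le j$ and $i+2\le j$, which gives commutation. For larger $i$ both labels act on the last
    14 points only. *)
Let below (i x : nat) := (x <= i + 3) || (r + 4 <= x <= r + i + 2).

Lemma rho_comm i j : i < r -> j < r -> i.+1 < j -> commute (rho n i) (rho n j).
Proof.
move=> ir jr ij; case: (leqP j 2) => j2.
  have [-> ->] : i = 0%N /\ j = 2 by clear -ij j2; lia.
  have := @same_low_actP n r r8 En [:: 0%N; 2] [:: 2; 0%N] isT isT isT.
  by rewrite !big_cons big_nil !mulg1.
case: (leqP i (r - 6)) => i6; last first.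
  apply: comm_of_invol; rewrite ?rho_invol //.
  have := @word_eq1 [:: r - i; r - j; r - i; r - j]%N.
  rewrite !big_cons big_nil mulg1 !subKn ?(ltnW ir, ltnW jr) // -!mulgA; apply.
    by rewrite /=; clear -ir jr i6 ij; lia.
  have : [|| (r - i == 5) && (r - j \in [:: 3; 2; 1%N]),
             (r - i == 4) && (r - j \in [:: 2; 1%N]) | (r - i == 3) && (r - j == 1%N)]%N.
    by rewrite !inE; clear -ir jr i6 ij; lia.
  by rewrite !inE; case/or3P => /andP[/eqP->]; [case/or3P | case/orP |]; move/eqP->.
have belowE x : below i x -> below i (mv r i x).
  by rewrite /below; clear -r8 i6 => h; rewrite /mv; ifs.
have aboveE x : ~~ below i x -> mv r i x = x.
  by rewrite /below; clear -r8 i6 => h; rewrite /mv; ifs.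
have fixE x : below i x -> mv r j x = x.
  by rewrite /below; clear -r8 i6 ij j2 jr => h; rewrite /mv; ifs.
apply: eq_ev => x _; rewrite !evM !(ev_rho _ r8 En ir) !(ev_rho _ r8 En jr).
case: (boolP (below i x)) => hx; first by rewrite (fixE x) // fixE ?belowE.
rewrite (aboveE x) // aboveE //; apply: contra hx => hx.
have : mv r j (mv r j x) = mv r j x by rewrite fixE.
by rewrite -!(ev_rho _ r8 En jr) => /ev_inj e; rewrite (ev_rho _ r8 En jr) in e; rewrite -e.
Qed.

Lemma ev_exp (s : {perm 'I_n}) p x : ev (s ^+ p) x = iter p (ev s) x.
Proof. by elim: p x => [|p IHp] x; rewrite ?ev1 // expgS evM IHp iterSr. Qed.

Lemma order_prime (s : {perm 'I_n}) p x : prime p -> s ^+ p = 1 -> ev s x != x -> #[s] = p.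
Proof.
move=> p_pr sp sx; apply: nt_prime_order => //.
by apply: contraNneq sx => ->; rewrite ev1.
Qed.

Lemma order6 (s : {perm 'I_n}) x y : s ^+ 6 = 1 -> iter 2 (ev s) x != x ->
  iter 3 (ev s) y != y -> #[s] = 6.
Proof.
rewrite -!ev_exp => s6 s2 s3; have: #[s] %| 6 by rewrite order_dvdn s6.
have n2 : ~~ (#[s] %| 2) by rewrite order_dvdn; apply: contraNneq s2 => ->; rewrite ev1.
have n3 : ~~ (#[s] %| 3) by rewrite order_dvdn; apply: contraNneq s3 => ->; rewrite ev1.
by move: n2 n3; case: #[s] => [|[|[|[|[|[|[|o]]]]]]] // _ _ /dvdn_leq; move/(_ isT).
Qed.

Lemma order4 (s : {perm 'I_n}) x : s ^+ 4 = 1 -> iter 2 (ev s) x != x -> #[s] = 4.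
Proof.
rewrite -!ev_exp => s4 s2; have: #[s] %| 4 by rewrite order_dvdn s4.
have n2 : ~~ (#[s] %| 2) by rewrite order_dvdn; apply: contraNneq s2 => ->; rewrite ev1.
by move: n2; case: #[s] => [|[|[|[|[|o]]]]] // _ /dvdn_leq; move/(_ isT).
Qed.

Lemma exp_word (i j p : nat) : (rho n i * rho n j) ^+ p =
  \prod_(l <- flatten (nseq p [:: i; j])) rho n l.
Proof.
elim: p => [|p IHp]; first by rewrite big_nil.
by rewrite expgS IHp /= !big_cons mulgA.
Qed.

Lemma order_low i : 0 < i <= 2 -> #[rho n i.-1 * rho n i] = 5.
Proof.
move=> hi; have i3 : i < 3 by case/andP: hi.
have low5 w : all (fun l => l < 3) w -> same_low_act w [::] -> \prod_(l <- w) rho n l = 1.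
  by move=> w3 e; rewrite (same_low_actP r8 En w3 _ e) ?big_nil.
apply: (@order_prime _ 5 1%N) => //.
  by rewrite exp_word; apply: low5; move: hi; case: i {i3} => [|[|[|]]].
rewrite evM !(ev_rho _ r8 En); [|clear -hi r8; lia..].
by move: hi; case: i {i3} => [|[|[|]]].
Qed.

Lemma order_2_3 : #[rho n 2 * rho n 3] = 6.
Proof.
have E x : ev (rho n 2 * rho n 3) x = mv r 3 (mv r 2 x).
  by rewrite evM !(ev_rho _ r8 En) //; clear -r8; lia.
have [e2 e3 e4 e5] : [/\ ev (rho n 2 * rho n 3) 2 = 3, ev (rho n 2 * rho n 3) 3 = 2,
    ev (rho n 2 * rho n 3) 4 = 6 & ev (rho n 2 * rho n 3) 5 = 4].
  by rewrite !E; split; clear -r8; rewrite /mv /=; ifs.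
have e6 : ev (rho n 2 * rho n 3) 6 = 5 by rewrite E; clear -r8; rewrite /mv /=; ifs.
have ez : ev (rho n 2 * rho n 3) (r + 4) = (r + 5)%N.
  by rewrite E; clear -r8; rewrite /mv /=; ifs.
have ez' : ev (rho n 2 * rho n 3) (r + 5) = (r + 4)%N.
  by rewrite E; clear -r8; rewrite /mv /=; ifs.
have eo x : ~~ (2 <= x <= 6) -> ~~ (r + 4 <= x <= r + 5) -> ev (rho n 2 * rho n 3) x = x.
  by rewrite E; clear -r8 => h1 h2; rewrite /mv /=; ifs.
(* The point 4 lies in a 3-cycle and 2 in a transposition of the product. *)
apply: (@order6 _ 4 2); [|by rewrite /= !(e2, e3, e4, e5, e6)..].
apply: eq_ev => x _; rewrite ev_exp ev1.
case: (boolP (2 <= x <= 6)) => [|h1].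
  by case: x => [|[|[|[|[|[|[|]]]]]]] // _; rewrite /= !(e2, e3, e4, e5, e6).
case: (boolP (r + 4 <= x <= r + 5)) => [h2|h2]; last by rewrite /= !(eo x).
have [->|->] : x = (r + 4)%N \/ x = (r + 5)%N by clear -h2; lia.
  by rewrite /= !(ez, ez').
by rewrite /= !(ez, ez').
Qed.

Lemma order_middle i : 3 < i <= r - 5 -> #[rho n i.-1 * rho n i] = 3.
Proof.
case: i => // k hk; rewrite /=.
have E x : ev (rho n k * rho n k.+1) x = mv r k.+1 (mv r k x).
  by rewrite evM !(ev_rho _ r8 En) //; clear -r8 hk; lia.
have cyc y : y = (k + 2)%N \/ y = (r + k + 1)%N ->
    [/\ ev (rho n k * rho n k.+1) y = y.+2, ev (rho n k * rho n k.+1) y.+1 = y &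
        ev (rho n k * rho n k.+1) y.+2 = y.+1].
  by rewrite !E; clear -r8 hk => hy; split; rewrite /mv; ifs.
have eo x : ~~ (k + 2 <= x <= k + 4) -> ~~ (r + k + 1 <= x <= r + k + 3) ->
    ev (rho n k * rho n k.+1) x = x.
  by rewrite E; clear -r8 hk => h1 h2; rewrite /mv; ifs.
apply: (@order_prime _ 3 (k + 2)%N) => //; last first.
  by have [-> _ _] := cyc (k + 2)%N (or_introl erefl); clear; lia.
apply: eq_ev => x _; rewrite ev_exp ev1.
have cyc3 y : y = (k + 2)%N \/ y = (r + k + 1)%N -> y <= x <= y.+2 ->
    iter 3 (ev (rho n k * rho n k.+1)) x = x.
  move=> /cyc[e0 e1 e2] hx; have [->|[->|->]] : x = y \/ x = y.+1 \/ x = y.+2.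
    by clear -hx; lia.
  - by rewrite /= !(e0, e1, e2).
  - by rewrite /= !(e0, e1, e2).
  - by rewrite /= !(e0, e1, e2).
case: (boolP (k + 2 <= x <= k + 4)) => [h|h1].
  by apply: (cyc3 (k + 2)%N); [left | clear -h; lia].
case: (boolP (r + k + 1 <= x <= r + k + 3)) => [h|h2].
  by apply: (cyc3 (r + k + 1)%N); [right | clear -h; lia].
by rewrite /= !eo.
Qed.

Lemma order_top l : 1 < l <= 5 ->
  #[rho n (r - l) * rho n (r - l.-1)] = nth 0%N [:: 0; 0; 4; 6; 6; 6]%N l.
Proof.
move=> hl; have expE p : (rho n (r - l) * rho n (r - l.-1)) ^+ p =
    \prod_(i <- flatten (nseq p [:: l; l.-1])) rho n (r - i).
  elim: p => [|p IHp]; first by rewrite big_nil.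
  by rewrite expgS IHp /= !big_cons mulgA.
have l5 p : all (fun i => 0 < i <= 5) (flatten (nseq p [:: l; l.-1])).
  by elim: p => //= p ->; rewrite andbT; clear -hl; lia.
have exp1 p : all (fun q => word_mv (flatten (nseq p [:: l; l.-1])) q == q) (iota 0 14) ->
    (rho n (r - l) * rho n (r - l.-1)) ^+ p = 1.
  by move=> h; rewrite expE word_eq1.
have iter_pt p q : q < 14 -> word_mv (flatten (nseq p [:: l; l.-1])) q != q ->
    iter p (ev (rho n (r - l) * rho n (r - l.-1))) (pt r q) != pt r q.
  move=> q14; apply: contraNneq => e; apply/eqP/(pt_inj r8); rewrite ?word_mv_lt //.
  by rewrite -(ev_word r8 En (l5 p) q14) -expE ev_exp.
move: hl exp1 iter_pt; case: l {expE l5} => [|[|[|[|[|[|]]]]]] //= _ exp1 iter_pt.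
- by apply: (@order4 _ (pt r 3)); [exact: exp1 | exact: (iter_pt 2)].
- by apply: (@order6 _ (pt r 2) (pt r 5)); [exact: exp1 | exact: (iter_pt 2) | exact: (iter_pt 3)].
- by apply: (@order6 _ (pt r 1) (pt r 3)); [exact: exp1 | exact: (iter_pt 2) | exact: (iter_pt 3)].
- by apply: (@order6 _ (pt r 0) (pt r 4)); [exact: exp1 | exact: (iter_pt 2) | exact: (iter_pt 3)].
Qed.

Lemma schlafli_rho : schlafli r (rho n) = [:: 5; 5; 6] ++ nseq (r - 8) 3 ++ [:: 6; 6; 6; 4].
Proof.
have [d def_r] : exists d, r = (d + 8)%N by exists (r - 8)%N; rewrite subnK.
rewrite /schlafli {1}def_r (_ : (d + 8).-1 = 3 + (d + 4))%N; last by clear; lia.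
rewrite iotaD map_cat; congr (_ ++ _).
  by rewrite /= (order_low (i := 1)) // (order_low (i := 2)) // order_2_3.
rewrite iotaD map_cat {1}def_r addnK; congr (_ ++ _).
  apply: (@eq_from_nth _ 0%N); rewrite size_map size_iota ?size_nseq // => i hi.
  rewrite (nth_map 0%N) ?size_iota // nth_iota // nth_nseq hi order_middle //.
  by rewrite def_r; clear -hi; lia.
have top l : 1 < l <= 5 -> #[rho n (r - l.-1).-1 * rho n (r - l.-1)] =
    nth 0%N [:: 0; 0; 4; 6; 6; 6]%N l.
  by move=> hl; rewrite -order_top // (_ : (r - l.-1).-1 = r - l)%N //; clear -hl r8; lia.
rewrite (_ : iota _ 4 = [:: r - 4; r - 3; r - 2; r - 1]%N) /=.
  by rewrite (top 5) // (top 4) // (top 3) // (top 2).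
by rewrite /= def_r; do !congr (_ :: _); clear; lia.
Qed.

End Orders.

Theorem theorem4p9 (n : nat) :
  19 <= n -> n %% 4 = 3 ->
  let r := rk n in
  Ggrp n \isog 'Alt_('I_n) /\
  string_C_group (Ggrp n) r (rho n) /\
  schlafli r (rho n) = [:: 5; 5; 6] ++ nseq (r - 8) 3 ++ [:: 6; 6; 6; 4].
Proof.
move=> n19 n3 r.
have r8 : 8 <= r by rewrite /r /rk; clear -n19; lia.
have En : n = r.*2.+3 by rewrite /r /rk; clear -n19 n3; lia.
have full : [set: 'I_r] = itv r 0 r by apply/setP=> x; rewrite !inE ltn_ord.
have GE : Ggrp n = 'Alt_('I_n).
  apply/setP=> s; rewrite Alt_even; apply/idP/idP => [/(even_gen r8 En)//|s_even].
  have hm : 3 <= r.-1 < r by clear -r8; lia.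
  have := alt_on_low r8 En (leq0n 2) hm; rewrite {1}prednK; last by clear -r8; lia.
  rewrite /Ggrp -/r full; apply=> // x; rewrite {1}En /upper /last_y /low /=; clear -r8.
  by move=> xn /negP[]; lia.
split; first by rewrite GE isog_refl.
split; last exact: schlafli_rho.
split; first split=> // [i ir|i j ir jr ij].
- exact: (order_rho r8 En).
- have c : commute (rho n i) (rho n j).
    by case/orP: ij => ij; [|apply/commute_sym]; apply: (rho_comm r8 En).
  have sq k : k < r -> rho n k ^+ 2 = 1.
    by move=> kr; rewrite -(order_rho r8 En kr) expg_order.
  by rewrite expgMn // !sq ?mulg1.
apply: intersection_of_itv => [i j|m k]; [exact: (rho_comm r8 En) | exact: itv_intersection].
Qed.
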